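(* Let $M$ be a generalized Kähler manifold, regarded as a bihermitian manifold $(M,g,I_+,I_-,b)$ with $d^c_-\omega_-=db=-d^c_+\omega_+$. Let $\sigma_+$ be the section of $\Lambda^2T^{1,0}$ (type with respect to $I_+$) corresponding to the $(0,2)$ part of the 2-form $S(X,Y)=g([I_+,I_-]X,Y)$. Then $\sigma_+$ is a holomorphic Poisson structure on the complex manifold $(M,I_+)$, i.e. $\sigma_+$ is a holomorphic bivector field and its Schouten bracket satisfies $[\sigma_+,\sigma_+]=0$.
   Context: A generalized Kähler structure is equivalent (Gualtieri) to the following bihermitian data: a Riemannian metric $g$; two integrable complex structures $I_+,I_-$, each orthogonal for $g$; and a real 2-form $b$ with $d^c_-\omega_-=db=-d^c_+\omega_+$, where $\omega_\pm(X,Y)=g(I_\pm X,Y)$ are the Hermitian forms and $d^c_\pm=i(\bar\partial-\partial)$ for the complex structure $I_\pm$. The form $S(X,Y)=g([I_+,I_-]X,Y)$, with $[I_+,I_-]=I_+I_--I_-I_+$, is skew and of type $(2,0)+(0,2)$ with respect to $I_+$. The complex-bilinear extension of $g$ identifies $(T^* )^{0,1}$ with $T^{1,0}$ (types with respect to $I_+$), and $\sigma_+$ is the section of $\Lambda^2T^{1,0}$ corresponding to the $(0,2)$ part of $S$ under this identification. In local $I_+$-holomorphic coordinates $z_i$, it is, up to a constant factor, $\sum(I_-dz_i,dz_j)\frac{\partial}{\partial z_i}\wedge\frac{\partial}{\partial z_j}$, where $(\cdot,\cdot)$ is the complex-bilinear inner product on 1-forms given by $g$ and $I_-$ acts on 1-forms.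 *)

(* Defs.v *)
(* R is an arbitrary realType and C stands for R[i]. *)
From HB Require Import structures.
From mathcomp Require Import all_boot all_order all_algebra.
From mathcomp Require Import all_classical all_reals all_analysis.
From mathcomp.real_closed Require Import complex.
Set Implicit Arguments.
Unset Strict Implicit.
Unset Printing Implicit Defensive.
Import Order.TTheory GRing.Theory Num.Theory.
Import numFieldNormedType.Exports.
Local Open Scope classical_set_scope.
Local Open Scope ring_scope.

Section Calculus.
Variables (R : realType) (n : nat).
Implicit Types (U : set 'rV[R]_n) (x : 'rV[R]_n).

Definition pder (a : 'I_n) (f : 'rV[R]_n -> R) x : R := 'D_(delta_mx 0 a) f x.

(* pderC extends pder complex-linearly to complex-valued functions of real
   coordinates. *)
Definition pderC (a : 'I_n) (f : 'rV[R]_n -> R[i]) x : R[i] :=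
  Complex (pder a (fun y => complex.Re (f y)) x)
          (pder a (fun y => complex.Im (f y)) x).

(* Infinite differentiability: every iterated partial derivative (the empty
   word s gives f itself) is Frechet differentiable, hence continuous. *)
Definition smooth_on U (f : 'rV[R]_n -> R) : Prop :=
  forall (s : seq 'I_n) x, U x -> differentiable (foldr pder f s) x.

Definition smooth_map_on (k : nat) U (f : 'rV[R]_n -> 'rV[R]_k) : Prop :=
  forall i : 'I_k, smooth_on U (fun x => f x 0 i).

End Calculus.

(* cmap is a homeomorphism of cdom onto an open subset of R^n, with inverse
   cinv; the values of cmap off cdom and of cinv off the image are junk. *)
Record chart (R : realType) (n : nat) (M : topologicalType) := Chart {
  cdom : set M;
  cmap : M -> 'rV[R]_n;
  cinv : 'rV[R]_n -> M;
  cdom_open : open cdom;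
  cimg_open : open (cmap @` cdom);
  cmapK : forall p, cdom p -> cinv (cmap p) = p;
  cmap_continuous : {within cdom, continuous cmap};
  cinv_continuous : {within cmap @` cdom, continuous cinv}
}.

Section Charts.
Variables (R : realType) (n : nat) (M : topologicalType).
Implicit Types c : chart R n M.

Definition cimg c : set 'rV[R]_n := cmap c @` cdom c.

Definition transition c c' : 'rV[R]_n -> 'rV[R]_n := cmap c' \o cinv c.

Definition smooth_transition c c' : Prop :=
  smooth_map_on (cmap c @` (cdom c `&` cdom c')) (transition c c').

Definition compatible c c' : Prop :=
  smooth_transition c c' /\ smooth_transition c' c.

End Charts.

(* The atlas is maximal, so it contains every smooth local coordinate system. *)
Record smoothManifold (R : realType) (n : nat) := SmoothManifold {
  carrier :> topologicalType;
  atlas : set (chart R n carrier);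
  carrier_hausdorff : hausdorff_space carrier;
  carrier_second_countable : @second_countable carrier;
  atlas_cover : forall p : carrier, exists2 c, atlas c & cdom c p;
  atlas_compatible : forall c c', atlas c -> atlas c' -> compatible c c';
  atlas_maximal :
    forall c, (forall c', atlas c' -> compatible c c') -> atlas c
}.

(* Tensor fields are given classically, by their components in every chart of
   the atlas, as functions of the coordinates x in cimg c, subject to the
   transformation law of their type.  Tangent vectors are columns of components
   and an endomorphism A acts on them on the left: A d_j = \sum_i A i j d_i.
   A (complex) bilinear form, or bivector, is the matrix of its components. *)
Section TensorFields.
Variables (R : realType) (n : nat) (M : smoothManifold R n).
Local Notation C := R[i].

Definition field_on (T : Type) : Type := chart R n M -> 'rV[R]_n -> T.

(* 'J acts on rows, so the transpose has entry (i, j) equal to dx'_i / dx_j. *)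
Definition tjac (c c' : chart R n M) (x : 'rV[R]_n) : 'M[R]_n :=
  ('J (transition c c') x)^T.

Definition mxC (k l : nat) (A : 'M[R]_(k, l)) : 'M[C]_(k, l) :=
  map_mx (fun t : R => Complex t 0) A.

Definition bilinear_law (T : field_on 'M[R]_n) : Prop :=
  forall c c', atlas c -> atlas c' -> forall p, cdom c p -> cdom c' p ->
  T c (cmap c p) = (tjac c c' (cmap c p))^T *m T c' (cmap c' p)
                     *m tjac c c' (cmap c p).

Definition endo_law (T : field_on 'M[R]_n) : Prop :=
  forall c c', atlas c -> atlas c' -> forall p, cdom c p -> cdom c' p ->
  tjac c c' (cmap c p) *m T c (cmap c p)
    = T c' (cmap c' p) *m tjac c c' (cmap c p).

Definition bivector_law (T : field_on 'M[C]_n) : Prop :=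
  forall c c', atlas c -> atlas c' -> forall p, cdom c p -> cdom c' p ->
  T c' (cmap c' p) = mxC (tjac c c' (cmap c p)) *m T c (cmap c p)
                       *m (mxC (tjac c c' (cmap c p)))^T.

Definition smooth_field (T : field_on 'M[R]_n) : Prop :=
  forall c, atlas c -> forall i j, smooth_on (cimg c) (fun x => T c x i j).

Record riemannian_metric := RiemannianMetric {
  metric :> field_on 'M[R]_n;
  metric_law : bilinear_law metric;
  metric_smooth : smooth_field metric;
  metric_sym : forall c x, atlas c -> cimg c x -> (metric c x)^T = metric c x;
  metric_pos : forall c x, atlas c -> cimg c x ->
    forall v : 'cV[R]_n, v != 0 -> 0 < (v^T *m metric c x *m v) 0 0
}.

Record two_form := TwoForm {
  tform :> field_on 'M[R]_n;
  tform_law : bilinear_law tform;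
  tform_smooth : smooth_field tform;
  tform_skew : forall c x, atlas c -> cimg c x -> (tform c x)^T = - tform c x
}.

End TensorFields.

Identity Coercion fun_of_field_on : field_on >-> Funclass.

(* Linear algebra at a point: A is the matrix of a complex structure on the
   tangent space, acting on the complexified tangent space. *)
Section Types.
Variables (R : realType) (n : nat).
Local Notation C := R[i].
Local Notation iC := (Complex 0 1 : C).

(* Projections of the complexified tangent space: tproj A true is
   (1 - iA)/2, onto T^{1,0}, and tproj A false is (1 + iA)/2, onto T^{0,1}. *)
Definition tproj (A : 'M[R]_n) (e : bool) : 'M[C]_n :=
  (2%:R : C)^-1 *: (1%:M + (if e then - iC else iC) *: mxC A).

(* Component of type (p, 2 - p) of a 2-form. *)
Definition type2 (A : 'M[R]_n) (p : nat) (al : 'M[C]_n) : 'M[C]_n :=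
  \sum_(e : bool * bool | (e.1 + e.2 == p)%N)
    (tproj A e.1)^T *m al *m tproj A e.2.

(* Component of type (p, 3 - p) of a 3-form. *)
Definition type3 (A : 'M[R]_n) (p : nat) (be : 'I_n -> 'I_n -> 'I_n -> C)
    (a b c : 'I_n) : C :=
  \sum_(e : bool * bool * bool | (e.1.1 + e.1.2 + e.2 == p)%N)
    \sum_i \sum_j \sum_k
      be i j k * tproj A e.1.1 i a * tproj A e.1.2 j b * tproj A e.2 k c.

(* Exterior derivative of a 2-form with skew matrix al. *)
Definition extd (al : 'rV[R]_n -> 'M[C]_n) (x : 'rV[R]_n) (a b c : 'I_n) : C :=
  pderC a (fun y => al y b c) x + pderC b (fun y => al y c a) x
    + pderC c (fun y => al y a b) x.

(* On the (p, 2 - p) part of a 2-form, del and delbar are the (p + 1, 2 - p)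
   and (p, 3 - p) parts of the exterior derivative. *)
Definition del (A : 'rV[R]_n -> 'M[R]_n) (al : 'rV[R]_n -> 'M[C]_n)
    (x : 'rV[R]_n) (a b c : 'I_n) : C :=
  \sum_(p < 3)
    type3 (A x) p.+1 (extd (fun y => type2 (A y) p (al y)) x) a b c.

Definition delbar (A : 'rV[R]_n -> 'M[R]_n) (al : 'rV[R]_n -> 'M[C]_n)
    (x : 'rV[R]_n) (a b c : 'I_n) : C :=
  \sum_(p < 3)
    type3 (A x) p (extd (fun y => type2 (A y) p (al y)) x) a b c.

Definition dc (A : 'rV[R]_n -> 'M[R]_n) (al : 'rV[R]_n -> 'M[C]_n)
    (x : 'rV[R]_n) (a b c : 'I_n) : C :=
  iC * (delbar A al x a b c - del A al x a b c).

End Types.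

(* C^m is R^(m + m) with z_j = x_j + i y_j, where x_j is the real coordinate of
   index lshift m j and y_j the one of index rshift m j. *)
Section ComplexCoordinates.
Variables (R : realType) (m : nat).
Local Notation C := R[i].
Local Notation iC := (Complex 0 1 : C).

(* The standard structure: d/dx_j |-> d/dy_j and d/dy_j |-> - d/dx_j. *)
Definition stdJ : 'M[R]_(m + m) := block_mx 0 (- 1%:M) 1%:M 0.

(* Row j is the covector dz_j = dx_j + i dy_j. *)
Definition dz : 'M[C]_(m, m + m) := row_mx 1%:M (iC *: 1%:M).

Definition der_z (j : 'I_m) (f : 'rV[R]_(m + m) -> C) (x : 'rV[R]_(m + m)) : C :=
  2%:R^-1 * (pderC (lshift m j) f x - iC * pderC (rshift m j) f x).

Definition der_zbar (j : 'I_m) (f : 'rV[R]_(m + m) -> C) (x : 'rV[R]_(m + m)) : C :=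
  2%:R^-1 * (pderC (lshift m j) f x + iC * pderC (rshift m j) f x).

Definition holomorphic_on (U : set 'rV[R]_(m + m)) (f : 'rV[R]_(m + m) -> C) :
    Prop :=
  forall x, U x ->
    [/\ differentiable (fun y => complex.Re (f y)) x,
        differentiable (fun y => complex.Im (f y)) x
      & forall j, der_zbar j f x = 0].

(* Component (i, j, k) of the Schouten bracket of the bivector fields
   1/2 \sum P i j d/dz_i /\ d/dz_j and 1/2 \sum Q i j d/dz_i /\ d/dz_j with
   holomorphic coefficients, as determined by
   [X /\ Y, Z /\ W] = [X, Z] /\ Y /\ W - [X, W] /\ Y /\ Z
                      - [Y, Z] /\ X /\ W + [Y, W] /\ X /\ Z. *)
Definition schouten (P Q : 'rV[R]_(m + m) -> 'M[C]_m) (x : 'rV[R]_(m + m))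
    (i j k : 'I_m) : C :=
  let half (P Q : 'rV[R]_(m + m) -> 'M[C]_m) :=
    \sum_l (P x i l * der_z l (fun y => Q y j k) x
            + P x j l * der_z l (fun y => Q y k i) x
            + P x k l * der_z l (fun y => Q y i j) x) in
  half P Q + half Q P.

End ComplexCoordinates.

Section Bihermitian.
Variables (R : realType) (m : nat) (M : smoothManifold R (m + m)).
Local Notation C := R[i].
Local Notation n := (m + m)%N.

Definition holomorphic_chart (A : field_on M 'M[R]_n) (c : chart R n M) : Prop :=
  atlas c /\ forall x, cimg c x -> A c x = stdJ R m.

(* Integrability means that A comes from a holomorphic atlas: near every point
   there are smooth coordinates x_j, y_j such that A is the standard structure
   of the z_j = x_j + i y_j. *)
Record complex_structure := ComplexStructure {
  cstr :> field_on M 'M[R]_n;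
  cstr_law : endo_law cstr;
  cstr_smooth : smooth_field cstr;
  cstr_sq : forall c x, atlas c -> cimg c x -> cstr c x *m cstr c x = - 1%:M;
  cstr_integrable :
    forall p : M, exists2 c, holomorphic_chart cstr c & cdom c p
}.

(* The bilinear form (X, Y) |-> g (A X, Y). *)
Definition lower (g A : 'M[R]_n) : 'M[R]_n := A^T *m g.

Record bihermitian := Bihermitian {
  bh_g : riemannian_metric M;
  bh_Ip : complex_structure;
  bh_Im : complex_structure;
  bh_b : two_form M;
  bh_Ip_orth : forall c x, atlas c -> cimg c x ->
    (bh_Ip c x)^T *m bh_g c x *m bh_Ip c x = bh_g c x;
  bh_Im_orth : forall c x, atlas c -> cimg c x ->
    (bh_Im c x)^T *m bh_g c x *m bh_Im c x = bh_g c x;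
  bh_dcm : forall c x, atlas c -> cimg c x -> forall i j k,
    dc (bh_Im c) (fun y => mxC (lower (bh_g c y) (bh_Im c y))) x i j k
      = extd (fun y => mxC (bh_b c y)) x i j k;
  bh_dcp : forall c x, atlas c -> cimg c x -> forall i j k,
    extd (fun y => mxC (bh_b c y)) x i j k
      = - dc (bh_Ip c) (fun y => mxC (lower (bh_g c y) (bh_Ip c y))) x i j k
}.

Definition S_form (B : bihermitian) : field_on M 'M[R]_n := fun c x =>
  lower (bh_g B c x) (bh_Ip B c x *m bh_Im B c x - bh_Im B c x *m bh_Ip B c x).

(* g identifies a vector X with the 1-form g (X, -), so the bivector of a
   2-form al is obtained by raising both indices with the inverse of g. *)
Definition sigma_plus (B : bihermitian) : field_on M 'M[C]_n := fun c x =>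
  let ginv := mxC (invmx (bh_g B c x)) in
  ginv *m type2 (bh_Ip B c x) 0 (mxC (S_form B c x)) *m ginv^T.

(* The matrix of the P (dz_i, dz_j); P = 1/2 \sum P (dz_i, dz_j) d/dz_i /\ d/dz_j
   when P is a section of Lambda^2 T^{1,0}. *)
Definition zcomp (P : field_on M 'M[C]_n) (c : chart R n M) (x : 'rV[R]_n) :
    'M[C]_m :=
  dz R m *m P c x *m (dz R m)^T.

Definition section_L2T10 (A : complex_structure) (P : field_on M 'M[C]_n) : Prop :=
  bivector_law P /\
  forall c x, atlas c -> cimg c x ->
    (P c x)^T = - P c x /\ tproj (A c x) true *m P c x = P c x.

Definition holomorphic_bivector (A : complex_structure) (P : field_on M 'M[C]_n) :
    Prop :=
  section_L2T10 A P /\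
  forall c, holomorphic_chart A c ->
    forall i j, holomorphic_on (cimg c) (fun x => zcomp P c x i j).

Definition holomorphic_poisson (A : complex_structure) (P : field_on M 'M[C]_n) :
    Prop :=
  holomorphic_bivector A P /\
  forall c, holomorphic_chart A c -> forall x, cimg c x ->
    forall i j k, schouten (zcomp P c) (zcomp P c) x i j k = 0.

End Bihermitian.

(* Main.v *)
(** Write h = db.  For a Hermitian structure (g, I), integrability of I gives
    2 g((nabla_X I) Y, Z) = d^c omega(X, IY, Z) + d^c omega(X, Y, IZ), and d^c omega
    has no component of type (3,0) or (0,3).  Hence the metric connections
    nabla +- h/2, with torsion +- h, preserve I_+ and I_-, and h is of type
    (2,1) + (1,2) for both structures.  On the other hand sigma_+ is a constant
    multiple of P I_- g^-1 P^T, where P projects onto T^{1,0}, so in I_+-holomorphic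
    coordinates its components are multiples of dz_i (I_- g^-1) dz_j^T.  Their
    derivatives are expressed through the connection nabla + h/2 and h.  In an
    antiholomorphic direction all terms cancel because h has no (0,3) part; in the
    Schouten bracket the torsion terms add up to
    - sum_cyc h(I_- b_i, I_- b_j, b_k) = - h(b_i, b_j, b_k) = 0, where the vectors
    b_i = g^-1 dz_i lie in T^{0,1}. *)

Require Import Defs.
From mathcomp Require Import all_boot all_order all_algebra.
From mathcomp Require Import all_classical all_reals all_analysis.
From mathcomp.real_closed Require Import complex.
From mathcomp Require Import ring.
Set Implicit Arguments.
Unset Strict Implicit.
Unset Printing Implicit Defensive.
Import Order.TTheory GRing.Theory Num.Theory.
Import numFieldNormedType.Exports.
Local Open Scope classical_set_scope.
Local Open Scope ring_scope.

(** Both structures have to be treated in one I_+-holomorphic chart, where I_- is in general not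
    constant. Integrability, however, is given as the existence of holomorphic charts. It is
    therefore carried into an arbitrary chart as the vanishing of the Nijenhuis tensor, which rests
    on the symmetry of the second derivatives of a transition map; that symmetry is derived from
    differentiability alone.

    The opposite signs in the two d^c equations make the two structures parallel for connections
    with opposite torsion. All derivatives of the bivector are expressed through the connection of
    I_+: in a holomorphic chart T^{0,1} is spanned by constant vectors, is parallel and is isotropic
    for g, so g(nabla_X Y, Z) = 0 for constant Y, Z in it. The price is a correction by h for each
    occurrence of I_-.

    Having no part of type (3,0) or (0,3) is encoded by a single identity, t = [ins2] t, so that the
    pointwise arguments reduce to polynomial identities over an abstract field, with a square root
    of -1 where types are split. *)

Lemma scaled_sum_eq0 (S : pzRingType) (u a b c : S) :
  a + b + c = 0 -> u * a + u * b + u * c = 0.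
Proof. by move=> e; rewrite -!mulrDr e mulr0. Qed.

Lemma trmx_add (V : zmodType) p q (A B : 'M[V]_(p, q)) : (A + B)^T = A^T + B^T.
Proof. by apply/matrixP => i j; rewrite !mxE. Qed.

Lemma trmx_opp (V : zmodType) p q (A : 'M[V]_(p, q)) : (- A)^T = - A^T.
Proof. by apply/matrixP => i j; rewrite !mxE. Qed.

Lemma trmx_scale (S : pzRingType) p q u (A : 'M[S]_(p, q)) : (u *: A)^T = u *: A^T.
Proof. by apply/matrixP => i j; rewrite !mxE. Qed.

(** * Trilinear forms *)

Section Trilinear.
Variables (F : comNzRingType) (n : nat).
Implicit Types (t : 'I_n -> 'I_n -> 'I_n -> F) (X Y Z : 'cV[F]_n).

Definition tri t X Y Z : F :=
  \sum_i \sum_j \sum_k t i j k * X i 0 * Y j 0 * Z k 0.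

Lemma tri_swap t X Y Z : tri (fun a b c => t b a c) X Y Z = tri t Y X Z.
Proof.
rewrite /tri exchange_big /=; apply: eq_bigr => i _; apply: eq_bigr => j _.
by apply: eq_bigr => k _; ring.
Qed.

Lemma tri_cycle t X Y Z : tri (fun a b c => t b c a) X Y Z = tri t Y Z X.
Proof.
rewrite /tri exchange_big /=; apply: eq_bigr => i _; rewrite exchange_big /=.
by apply: eq_bigr => j _; apply: eq_bigr => k _; ring.
Qed.

Lemma tri_cycle2 t X Y Z : tri (fun a b c => t c a b) X Y Z = tri t Z X Y.
Proof. by rewrite (tri_cycle (fun a b c => t b c a)) (tri_cycle t). Qed.

Lemma tri_flip t X Y Z : tri (fun a b c => t a c b) X Y Z = tri t X Z Y.
Proof. by rewrite (tri_swap (fun a b c => t b c a)) (tri_cycle t). Qed.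

Lemma tri_lin1 t a X X' Y Z :
  tri t (a *: X + X') Y Z = a * tri t X Y Z + tri t X' Y Z.
Proof.
rewrite /tri !mulr_sumr -big_split; apply: eq_bigr => i _ /=.
rewrite !mulr_sumr -big_split; apply: eq_bigr => j _ /=.
rewrite !mulr_sumr -big_split; apply: eq_bigr => k _ /=.
by rewrite !mxE; ring.
Qed.

Lemma tri_lin2 t a X Y Y' Z :
  tri t X (a *: Y + Y') Z = a * tri t X Y Z + tri t X Y' Z.
Proof.
have E W : tri t X W Z = tri (fun a b c => t b a c) W X Z by rewrite (tri_swap t).
by rewrite !E tri_lin1.
Qed.

Lemma tri_lin3 t a X Y Z Z' :
  tri t X Y (a *: Z + Z') = a * tri t X Y Z + tri t X Y Z'.
Proof.
have E W : tri t X Y W = tri (fun a b c => t b c a) W X Y by rewrite (tri_cycle t).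
by rewrite !E tri_lin1.
Qed.

Lemma tri_sub1 t (A : 'M[F]_n) X Y Z :
  tri (fun a b c => \sum_i t i b c * A i a) X Y Z = tri t (A *m X) Y Z.
Proof.
rewrite /tri exchange_big [RHS]exchange_big; apply: eq_bigr => j _ /=.
rewrite exchange_big [RHS]exchange_big; apply: eq_bigr => k _ /=.
rewrite -!mulr_suml; congr (_ * _ * _).
under eq_bigr do rewrite mulr_suml.
rewrite exchange_big; apply: eq_bigr => i _ /=; rewrite mxE mulr_sumr.
by apply: eq_bigr => a _; rewrite mulrA.
Qed.

(** Substitution in the first slot is applied three times, with the arguments rotated in between. *)
Lemma tri_sub t (A B D : 'M[F]_n) X Y Z :
  tri (fun a b c => \sum_i \sum_j \sum_k t i j k * A i a * B j b * D k c) X Y Z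
  = tri t (A *m X) (B *m Y) (D *m Z).
Proof.
pose t1 a b c := \sum_i t i b c * A i a.
pose t2 a b c := \sum_i t1 b c i * D i a.
pose t3 a b c := \sum_i t2 b c i * B i a.
rewrite -tri_sub1 -/t1 -(tri_cycle t1) -tri_sub1 -/t2 -(tri_cycle t2).
rewrite -tri_sub1 -/t3 -(tri_cycle t3).
apply: eq_bigr => a _; apply: eq_bigr => b _; apply: eq_bigr => c _.
congr (_ * _ * _ * _); rewrite /t3 /t2 /t1 exchange_big.
apply: eq_bigr => j _; rewrite exchange_big mulr_suml; apply: eq_bigr => k _ /=.
by rewrite !mulr_suml; apply: eq_bigr => i _; ring.
Qed.

Lemma tri_mx (A : 'I_n -> 'M[F]_n) X Y Z :
  tri (fun a b c => A a b c) X Y Z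
  = (Y^T *m (\sum_a X a 0 *: A a) *m Z) 0 0.
Proof.
rewrite mulmx_sumr mulmx_suml summxE; apply: eq_bigr => a _.
rewrite -scalemxAr -scalemxAl !mxE exchange_big mulr_sumr; apply: eq_bigr => c _ /=.
rewrite mxE mulr_suml mulr_sumr; apply: eq_bigr => b _; rewrite !mxE; ring.
Qed.
End Trilinear.

Lemma eq_from_vanishing (F : pzRingType) (x y d : F) : d = 0 -> x - y = d -> x = y.
Proof. by move=> -> /subr0_eq. Qed.

(** * The covariant derivative of a Hermitian structure *)

(* D stands for g((nabla_X I) Y, Z) and cyc D for the exterior derivative of the
   Hermitian form; Dnij is the vanishing of the Nijenhuis tensor. *)
Section HermitianForm.
Variables (F : numFieldType) (V : zmodType) (I : V -> V) (D : V -> V -> V -> F).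
Hypothesis II : forall X, I (I X) = - X.
Hypothesis DN : forall X Y Z, D (- X) Y Z = - D X Y Z.
Hypothesis DNr : forall X Y Z, D X Y (- Z) = - D X Y Z.
Hypothesis Dskew : forall X Y Z, D X Z Y = - D X Y Z.
Hypothesis Dcom : forall X Y Z, D X (I Y) Z = D X Y (I Z).
Hypothesis Dnij : forall X Y Z,
  D (I X) Y Z - D (I Y) X Z + D X Y (I Z) - D Y X (I Z) = 0.

Definition cyc (t : V -> V -> V -> F) X Y Z := t X Y Z + t Y Z X + t Z X Y.
Let w := cyc D.

(** On forms of type (2,1) and (1,2) for [I] this operator is the identity, and on (3,0) and (0,3)
    it is multiplication by -3. Its fixed points are thus the forms of type (2,1) + (1,2). *)
Definition ins2 (t : V -> V -> V -> F) X Y Z :=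
  t (I X) (I Y) Z + t (I X) Y (I Z) + t X (I Y) (I Z).

(* If t has types (p, 3 - p) for I, acting with one I gives the eigenvalues
   3i, i, -i, -3i and with three I's the eigenvalues -i, i, -i, i; the coefficients
   are those for which the combination is 0, -i, i, 0, that is i (pi_12 - pi_21). *)
Definition dcform (t : V -> V -> V -> F) X Y Z :=
  - 4%:R^-1 * (t (I X) Y Z + t X (I Y) Z + t X Y (I Z)
               + 3%:R * t (I X) (I Y) (I Z)).

Let DNm X Y Z : D X (- Y) Z = - D X Y Z.
Proof. by rewrite Dskew DNr Dskew opprK. Qed.

Let wN1 X Y Z : w (- X) Y Z = - w X Y Z.
Proof. by rewrite /w /cyc DN DNr DNm; ring. Qed.
Let wN2 X Y Z : w X (- Y) Z = - w X Y Z.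
Proof. by rewrite /w /cyc DN DNr DNm; ring. Qed.
Let wN3 X Y Z : w X Y (- Z) = - w X Y Z.
Proof. by rewrite /w /cyc DN DNr DNm; ring. Qed.

Let DII X Y Z : D X (I Y) (I Z) = - D X Y Z.
Proof. by rewrite Dcom II DNr. Qed.

(** The Nijenhuis identity with second argument [I Z]. In this form it contains two of the three
    terms of [w X Y Z]. *)
Let nij' X Y Z : D Y Z X - D (I Y) (I Z) X + D Z X Y - D (I Z) X (I Y) = 0.
Proof.
have := Dnij Y (I Z) X; rewrite II DN DII (Dskew Z X) -(Dcom (I Z) Y) (Dskew (I Z) X) => H.
by apply: oppr_inj; rewrite oppr0 -[RHS]H; ring.
Qed.

(** The cyclic sum of [nij'] equals [w - ins2 w]: the terms without [I] add up to [2 w], and [DII]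
    produces one more [w] inside [ins2 w]. *)
Let w_ins2 X Y Z : w X Y Z = ins2 w X Y Z.
Proof.
have := congr2 +%R (congr2 +%R (nij' X Y Z) (nij' Y Z X)) (nij' Z X Y).
rewrite !addr0 => /eq_from_vanishing; apply; rewrite /w /ins2 /cyc !DII; ring.
Qed.

Let dcE X Y Z : dcform w X Y Z = - w (I X) (I Y) (I Z).
Proof.
(* Read at [I X], [w_ins2] says that the three terms with one [I] add up to the term with three;
   hence -(1 + 3)/4. *)
rewrite /dcform (w_ins2 (I X)) /ins2 !II !(wN1, wN2, wN3).
by field.
Qed.

Lemma dcform_nabla X Y Z :
  2%:R * D X Y Z = dcform w X (I Y) Z + dcform w X Y (I Z).
Proof.
(* The two terms differentiated along [X] are equal by [DII]; the other four form [nij' X Y Z]. *)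
have E : w X Y Z - w X (I Y) (I Z) = 2%:R * D X Y Z.
  by apply: (eq_from_vanishing (nij' X Y Z)); rewrite /w /cyc !DII; ring.
by rewrite !dcE !II wN2 wN3 !opprK -E {1}w_ins2 /ins2; ring.
Qed.

Lemma dcform_ins2 X Y Z : dcform w X Y Z = ins2 (dcform w) X Y Z.
Proof. by rewrite /ins2 !dcE w_ins2 /ins2; ring. Qed.
End HermitianForm.

Lemma tri_lin0 (F : comNzRingType) n (t t' : 'I_n -> 'I_n -> 'I_n -> F) u X Y Z :
  tri (fun a b c => u * t a b c + t' a b c) X Y Z = u * tri t X Y Z + tri t' X Y Z.
Proof.
rewrite /tri mulr_sumr -big_split; apply: eq_bigr => i _ /=.
rewrite mulr_sumr -big_split; apply: eq_bigr => j _ /=.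
by rewrite mulr_sumr -big_split; apply: eq_bigr => k _ /=; ring.
Qed.

Lemma eq_tri (F : comNzRingType) n (t t' : 'I_n -> 'I_n -> 'I_n -> F) X Y Z :
  (forall a b c, t a b c = t' a b c) -> tri t X Y Z = tri t' X Y Z.
Proof.
move=> E; apply: eq_bigr => a _; apply: eq_bigr => b _; apply: eq_bigr => c _.
by rewrite E.
Qed.

Section TriVectors.
Variables (F : comNzRingType) (n : nat) (t : 'I_n -> 'I_n -> 'I_n -> F).
Implicit Types X Y Z : 'cV[F]_n.

Lemma triD1 X X' Y Z : tri t (X + X') Y Z = tri t X Y Z + tri t X' Y Z.
Proof. by rewrite -{1}[X]scale1r tri_lin1 mul1r. Qed.
Lemma triD2 X Y Y' Z : tri t X (Y + Y') Z = tri t X Y Z + tri t X Y' Z.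
Proof. by rewrite -{1}[Y]scale1r tri_lin2 mul1r. Qed.
Lemma triD3 X Y Z Z' : tri t X Y (Z + Z') = tri t X Y Z + tri t X Y Z'.
Proof. by rewrite -{1}[Z]scale1r tri_lin3 mul1r. Qed.
Lemma triZ1 u X Y Z : tri t (u *: X) Y Z = u * tri t X Y Z.
Proof. by apply: (addIr (tri t X Y Z)); rewrite -tri_lin1 -triD1. Qed.
Lemma triZ2 u X Y Z : tri t X (u *: Y) Z = u * tri t X Y Z.
Proof. by apply: (addIr (tri t X Y Z)); rewrite -tri_lin2 -triD2. Qed.
Lemma triZ3 u X Y Z : tri t X Y (u *: Z) = u * tri t X Y Z.
Proof. by apply: (addIr (tri t X Y Z)); rewrite -tri_lin3 -triD3. Qed.
Lemma triN1 X Y Z : tri t (- X) Y Z = - tri t X Y Z.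
Proof. by rewrite -scaleN1r triZ1 mulN1r. Qed.
Lemma triN2 X Y Z : tri t X (- Y) Z = - tri t X Y Z.
Proof. by rewrite -scaleN1r triZ2 mulN1r. Qed.
Lemma triN3 X Y Z : tri t X Y (- Z) = - tri t X Y Z.
Proof. by rewrite -scaleN1r triZ3 mulN1r. Qed.
End TriVectors.

(* DG and DI are the coordinate derivatives of the matrices G and I at a point.
   Only Christoffel symbols of the first kind are used: g(nabla_X Y, Z) is
   tri chris X Y Z for constant Y, and nabla X Y Z is g((nabla_X I) Y, Z). *)
Section Hermitian.
Variables (F : numFieldType) (n : nat) (G I : 'M[F]_n) (DG DI : 'I_n -> 'M[F]_n).
Implicit Types X Y Z : 'cV[F]_n.

Definition dirm (A : 'I_n -> 'M[F]_n) X : 'M[F]_n := \sum_a X a 0 *: A a.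

Definition chris (a b c : 'I_n) : F :=
  2%:R^-1 * (DG a b c + DG b a c - DG c a b).

Definition dform (W : 'I_n -> 'M[F]_n) (a b c : 'I_n) : F :=
  W a b c + W b c a + W c a b.

Definition domega (a : 'I_n) : 'M[F]_n := (DI a)^T *m G + I^T *m DG a.

Definition nabla X Y Z : F :=
  tri (fun a b c => ((DI a)^T *m G) b c) X Y Z
  + tri chris X (I *m Y) Z + tri chris X Y (I *m Z).

Hypothesis I2 : I *m I = - 1%:M.
Hypothesis Gsym : G^T = G.
Hypothesis DGsym : forall a, (DG a)^T = DG a.
Hypothesis GI : I^T *m G = - (G *m I).
Hypothesis DI2 : forall a, DI a *m I + I *m DI a = 0.
Hypothesis DWskew : forall a, (domega a)^T = - domega a.
Hypothesis nijenhuis : forall X Y,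
  dirm DI (I *m X) *m Y - dirm DI (I *m Y) *m X
  - I *m dirm DI X *m Y + I *m dirm DI Y *m X = 0.

Lemma chrisE X Y Z : tri chris X Y Z = 2%:R^-1 *
  (tri (fun a b c => DG a b c) X Y Z + tri (fun a b c => DG a b c) Y X Z
   - tri (fun a b c => DG a b c) Z X Y).
Proof.
have E : 2%:R * tri chris X Y Z + tri (fun a b c => DG a b c) Z X Y
    = tri (fun a b c => DG a b c) X Y Z + tri (fun a b c => DG a b c) Y X Z.
  rewrite -(tri_swap (fun a b c => DG a b c) X Y).
  rewrite -[X in _ = X + _]mul1r -(tri_cycle2 _ X Y Z) -!tri_lin0.
  by apply: eq_tri => a b c; rewrite /chris; field.
by rewrite -E; field.
Qed.

Let g' X Y Z := tri (fun a b c => DG a b c) X Y Z.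

Let g'_sym X Y Z : g' X Y Z = g' X Z Y.
Proof.
rewrite /g' -(tri_flip (fun a b c => DG a b c)).
by apply: eq_tri => a b c; rewrite -[in LHS]DGsym mxE.
Qed.

Lemma chris_sym X Y Z : tri chris X Y Z = tri chris Y X Z.
Proof. by rewrite !chrisE -!/(g' _ _ _) (g'_sym Z); ring. Qed.

Lemma chris_metric X Y Z :
  tri chris X Y Z + tri chris X Z Y = tri (fun a b c => DG a b c) X Y Z.
Proof.
by rewrite !chrisE -!/(g' _ _ _) (g'_sym X Z); field.
Qed.

Lemma tri_mulr (A : 'I_n -> 'M[F]_n) (B : 'M[F]_n) X Y Z :
  tri (fun a b c => (A a *m B) b c) X Y Z = tri (fun a b c => A a b c) X Y (B *m Z).
Proof.
rewrite !tri_mx !mulmxA; congr ((_ *m _) 0 0).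
rewrite -!mulmxA; congr (_ *m _); rewrite mulmx_suml; apply: eq_bigr => a _.
by rewrite -scalemxAl.
Qed.

Lemma tri_mull (A : 'I_n -> 'M[F]_n) (B : 'M[F]_n) X Y Z :
  tri (fun a b c => (B^T *m A a) b c) X Y Z = tri (fun a b c => A a b c) X (B *m Y) Z.
Proof.
rewrite !tri_mx trmx_mul -[in RHS](mulmxA Y^T); congr ((_ *m _ *m _) 0 0).
rewrite mulmx_sumr; apply: eq_bigr => a _.
by rewrite -scalemxAr.
Qed.

Lemma tri_dirm (A : 'I_n -> 'M[F]_n) X Y Z :
  tri (fun a b c => ((A a)^T *m G) b c) X Y Z = ((dirm A X *m Y)^T *m G *m Z) 0 0.
Proof.
rewrite tri_mulr tri_mx trmx_mul -!mulmxA; congr ((_ *m (_ *m _)) 0 0).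
by rewrite linear_sum; apply: eq_bigr => a _; rewrite linearZ.
Qed.

Lemma tri_domega X Y Z : tri (fun a b c => domega a b c) X Y Z =
  tri (fun a b c => ((DI a)^T *m G) b c) X Y Z
  + tri (fun a b c => DG a b c) X (I *m Y) Z.
Proof.
rewrite -tri_mull -[X in _ = X + _]mul1r -tri_lin0.
by apply: eq_tri => a b c; rewrite mul1r mxE.
Qed.

Lemma tri_dform W X Y Z : tri (dform W) X Y Z =
  tri (fun a b c => W a b c) X Y Z + tri (fun a b c => W a b c) Y Z X
  + tri (fun a b c => W a b c) Z X Y.
Proof.
rewrite -(tri_cycle _ X) -(tri_cycle2 _ X Y Z).
rewrite -[X in X + _ + _]mul1r -[X in X + _]mul1r -!tri_lin0.
by apply: eq_tri => a b c; rewrite !mul1r.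
Qed.

(** The Levi-Civita connection is torsion free: in the cyclic sum the Christoffel terms by which the
    covariant and coordinate derivatives of the Hermitian form differ cancel in pairs. *)
Lemma cyc_nabla X Y Z : cyc nabla X Y Z = tri (dform domega) X Y Z.
Proof.
rewrite tri_dform !tri_domega -!chris_metric /cyc /nabla.
by rewrite (chris_sym X Z) (chris_sym Y X) (chris_sym Z Y); ring.
Qed.

Lemma nabla_skew X Y Z : nabla X Z Y = - nabla X Y Z.
Proof.
apply/eqP; rewrite -addr_eq0; apply/eqP.
have -> : nabla X Z Y + nabla X Y Z
   = tri (fun a b c => domega a b c) X Y Z + tri (fun a b c => domega a b c) X Z Y.
  by rewrite !tri_domega -!chris_metric /nabla; ring.
rewrite -(tri_flip (fun a b c => domega a b c) X Y) -[X in X + _]mul1r -tri_lin0.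
rewrite /tri big1 // => a _; rewrite big1 // => b _; rewrite big1 // => c _.
have E : domega a c b = - domega a b c.
  by have := congr1 (fun A : 'M[F]_n => A b c) (DWskew a); rewrite [LHS]mxE [RHS]mxE.
by rewrite mul1r E subrr !mul0r.
Qed.

Lemma nabla_com X Y Z : nabla X (I *m Y) Z = nabla X Y (I *m Z).
Proof.
rewrite /nabla !mulmxA I2 !mulNmx !mul1mx triN2 triN3.
suff E : tri (fun a b c => ((DI a)^T *m G) b c) X (I *m Y) Z
     = tri (fun a b c => ((DI a)^T *m G) b c) X Y (I *m Z) by rewrite E; ring.
rewrite -tri_mull -tri_mulr; apply: eq_tri => a b c.
rewrite mulmxA -trmx_mul (_ : DI a *m I = - (I *m DI a)).
  by rewrite linearN /= mulNmx trmx_mul -(mulmxA _ I^T) GI mulmxN opprK mulmxA.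
by apply/eqP; rewrite -addr_eq0 DI2.
Qed.

(** Paired with [Z] by the metric, the coordinate and covariant expressions of the Nijenhuis tensor
    differ by Christoffel terms, which cancel by symmetry in the first two arguments. *)
Lemma nabla_nij X Y Z : nabla (I *m X) Y Z - nabla (I *m Y) X Z
  + nabla X Y (I *m Z) - nabla Y X (I *m Z) = 0.
Proof.
have GIE (W : 'cV[F]_n) :
    (W^T *m G *m (I *m Z)) 0 0 = - ((I *m W)^T *m G *m Z) 0 0.
  by rewrite trmx_mul -(mulmxA _ I^T) GI mulmxN mulNmx [X in - X]mxE opprK !mulmxA.
rewrite /nabla !tri_dirm !GIE !mulmxA I2 !mulNmx !mul1mx !triN3.
rewrite (chris_sym (I *m X) (I *m Y)) (chris_sym (I *m X) Y).
rewrite (chris_sym (I *m Y) X) (chris_sym Y X).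
pose phi (W : 'cV[F]_n) := (W^T *m G *m Z) 0 0; rewrite -!/(phi _).
have phiD U W : phi (U + W) = phi U + phi W.
  by rewrite /phi trmx_add !mulmxDl mxE.
have phiN U : phi (- U) = - phi U.
  by rewrite /phi trmx_opp !mulNmx mxE.
have phi0 : phi 0 = 0 by rewrite /phi trmx0 !mul0mx mxE.
have := congr1 phi (nijenhuis X Y).
rewrite !(phiD, phiN) phi0 => E.
by apply: (eq_from_vanishing E); ring.
Qed.

Lemma nabla_dcform X Y Z : 2%:R * nabla X Y Z =
  dcform (mulmx I) (tri (dform domega)) X (I *m Y) Z
  + dcform (mulmx I) (tri (dform domega)) X Y (I *m Z).
Proof.
have II W : I *m (I *m W) = - W by rewrite mulmxA I2 mulNmx mul1mx.
rewrite /dcform -!cyc_nabla; apply: (dcform_nabla (D := nabla)).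
- by move=> ?; exact: II.
- by move=> ? ? ?; rewrite /nabla !triN1; ring.
- by move=> ? ? ?; rewrite /nabla mulmxN !triN3; ring.
- exact: nabla_skew.
- exact: nabla_com.
- exact: nabla_nij.
Qed.

Lemma dcform_domega_ins2 X Y Z : dcform (mulmx I) (tri (dform domega)) X Y Z =
  ins2 (mulmx I) (dcform (mulmx I) (tri (dform domega))) X Y Z.
Proof.
have II W : I *m (I *m W) = - W by rewrite mulmxA I2 mulNmx mul1mx.
rewrite /ins2 /dcform -!cyc_nabla; apply: (dcform_ins2 (D := nabla)).
- by move=> ?; exact: II.
- by move=> ? ? ?; rewrite /nabla !triN1; ring.
- by move=> ? ? ?; rewrite /nabla mulmxN !triN3; ring.
- exact: nabla_skew.
- exact: nabla_com.
- exact: nabla_nij.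
Qed.
End Hermitian.

(** * Pointwise algebra of the Poisson condition *)

(* L is the Levi-Civita connection, k is g((d_X K) Y, Z), g' is (d_X g)(Y, Z) and
   h is db, in coordinates in which J is constant.  k X Y Z + g' X Y (K Z) is the
   derivative along X of the bivector K g^-1 paired with the covectors g Z, g Y. *)
Section PoissonAlgebra.
Variables (F : numFieldType) (n : nat) (im : F) (J K : 'M[F]_n).
Variables (L h k g' : 'cV[F]_n -> 'cV[F]_n -> 'cV[F]_n -> F).
Implicit Types X Y Z : 'cV[F]_n.
Hypothesis im2 : im * im = -1.
Hypothesis JJ : J *m J = - 1%:M.
Hypothesis LD : forall X Y Y' Z, L X (Y + Y') Z = L X Y Z + L X Y' Z.
Hypothesis LZ2 : forall u X Y Z, L X (u *: Y) Z = u * L X Y Z.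
Hypothesis LZ3 : forall u X Y Z, L X Y (u *: Z) = u * L X Y Z.
Hypothesis Lsym : forall X Y Z, L Y X Z = L X Y Z.
Hypothesis Lmetric : forall X Y Z, L X Y Z + L X Z Y = g' X Y Z.
Hypothesis hD : forall X Y Y' Z, h X (Y + Y') Z = h X Y Z + h X Y' Z.
Hypothesis hZ : forall u X Y Z, h X (u *: Y) Z = u * h X Y Z.
Hypothesis hswap : forall X Y Z, h Y X Z = - h X Y Z.
Hypothesis hflip : forall X Y Z, h X Z Y = - h X Y Z.
Hypothesis hJ : forall X Y Z, h X Y Z = ins2 (mulmx J) h X Y Z.
Hypothesis hK : forall X Y Z, h X Y Z = ins2 (mulmx K) h X Y Z.
Hypothesis nablaJ : forall X Y Z,
  2%:R * (L X (J *m Y) Z + L X Y (J *m Z)) = - (h X (J *m Y) Z + h X Y (J *m Z)).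
Hypothesis nablaK : forall X Y Z,
  2%:R * (k X Y Z + L X (K *m Y) Z + L X Y (K *m Z))
    = h X (K *m Y) Z + h X Y (K *m Z).

(* The connection with torsion h, which preserves J. *)
Let Lp X Y Z := L X Y Z + 2%:R^-1 * h X Y Z.

Let E X Y Z := k X Y Z + g' X Y (K *m Z).

(** [nablaK] eliminates [k] and [Lmetric] eliminates [g']. Since [K] is parallel for the torsion
    opposite to that of [Lp], the halves of [h] from both sources add up instead of cancelling. *)
Let EE X Y Z : E X Y Z
  = Lp X (K *m Z) Y - Lp X (K *m Y) Z - h X (K *m Z) Y + h X (K *m Y) Z.
Proof.
have kE : k X Y Z = 2%:R^-1 * (h X (K *m Y) Z + h X Y (K *m Z))
    - L X (K *m Y) Z - L X Y (K *m Z).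
  by rewrite -nablaK; field.
by rewrite /E kE -Lmetric /Lp (hflip _ Y); field.
Qed.

Definition antihol X := J *m X = - im *: X.

Let im_neq0 : im != 0.
Proof.
by apply/eqP => im0; have /eqP := im2; rewrite im0 mul0r eq_sym oppr_eq0 oner_eq0.
Qed.

Let LpJ X Y Z : Lp X (J *m Y) Z = - Lp X Y (J *m Z).
Proof.
apply: (mulfI (x := 2%:R)); first by rewrite pnatr_eq0.
apply: (eq_from_vanishing (d := 2%:R * (L X (J *m Y) Z + L X Y (J *m Z)) + (h X (J *m Y) Z + h X Y (J *m Z)))).
  by rewrite nablaJ addNr.
by rewrite /Lp; field.
Qed.

Let LpD X Y Y' Z : Lp X (Y + Y') Z = Lp X Y Z + Lp X Y' Z.
Proof. by rewrite /Lp LD hD; ring. Qed.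

Let LpZ2 u X Y Z : Lp X (u *: Y) Z = u * Lp X Y Z.
Proof. by rewrite /Lp LZ2 hZ; ring. Qed.

Let hZ3 u X Y Z : h X Y (u *: Z) = u * h X Y Z.
Proof. by rewrite hflip hZ (hflip _ Y); ring. Qed.

Let hZ1 u X Y Z : h (u *: X) Y Z = u * h X Y Z.
Proof. by rewrite hswap hZ (hswap _ Y); ring. Qed.

Let LpZ3 u X Y Z : Lp X Y (u *: Z) = u * Lp X Y Z.
Proof. by rewrite /Lp LZ3 hZ3; ring. Qed.

(** The connection preserves T^{0,1}, which is isotropic for g. Both facts are contained in [LpJ],
    which here says that the value equals its own negative after division by i. *)
Let Lp0 X Y Z : antihol Y -> antihol Z -> Lp X Y Z = 0.
Proof.
move=> Y0 Z0; have := LpJ X Y Z; rewrite Y0 Z0 LpZ2 LpZ3 => e.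
apply: (mulfI im_neq0); apply: (mulfI (x := 2%:R)); first by rewrite pnatr_eq0.
move/eqP: e; rewrite -subr_eq0 => /eqP e; rewrite !mulr0 -[RHS]oppr0 -[in RHS]e.
ring.
Qed.

Let h0 X Y Z : antihol X -> antihol Y -> antihol Z -> h X Y Z = 0.
Proof.
move=> X0 Y0 Z0; have := hJ X Y Z; rewrite /ins2 X0 Y0 Z0 !(hZ1, hZ, hZ3) => e.
(* Each term of [ins2] contributes the factor (-i)^2, so [hJ] reads h = -3h. *)
apply: (mulfI (x := 4%:R)); first by rewrite pnatr_eq0.
move/eqP: e; rewrite -subr_eq0 => /eqP e; rewrite mulr0 -[in RHS]e.
by ring: im2.
Qed.

Definition holpart X := 2%:R^-1 *: (X - im *: (J *m X)).
Local Notation hol := holpart.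
Let ahol X := 2%:R^-1 *: (X + im *: (J *m X)).

Let hol_split X : X = hol X + ahol X.
Proof.
rewrite /holpart /ahol -scalerDr addrACA [- _ + _]addrC subrr addr0.
rewrite -[X in _ *: (X + _)]scale1r -[X in _ *: (_ + X)]scale1r -scalerDl.
by rewrite scalerA mulVf ?scale1r // pnatr_eq0.
Qed.

Let ahol_antihol X : antihol (ahol X).
Proof.
rewrite /antihol /ahol -scalemxAr mulmxDr -scalemxAr mulmxA JJ mulNmx mul1mx.
rewrite scalerA mulrC -scalerA; congr (_ *: _).
by rewrite scalerDr !scalerA mulNr im2 opprK scale1r scalerN addrC scaleNr.
Qed.

Let Lp_hol X Y Z : antihol Z -> Lp X Y Z = Lp X (hol Y) Z.
Proof. by move=> Z0; rewrite [in LHS](hol_split Y) LpD [X in _ + X]Lp0 ?addr0. Qed.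

Let Lp_torsion X Y Z : Lp X Y Z = Lp Y X Z + h X Y Z.
Proof. by rewrite /Lp Lsym (hswap X); field. Qed.

(** By the torsion, the derivative along [X] of a holomorphic part becomes a derivative of [X],
    killed by [Lp0], plus a term in [h]. Combined with the [h] terms of [EE] this leaves [h] on
    three vectors of T^{0,1}. *)
Lemma dbar_bivector X Y Z : antihol X -> antihol Y -> antihol Z ->
  k X Y Z + g' X Y (K *m Z) = 0.
Proof.
move=> X0 Y0 Z0; rewrite -/(E X Y Z) EE (Lp_hol X (K *m Z)) // (Lp_hol X (K *m Y)) // (Lp_torsion X (hol (K *m Z))).
rewrite (Lp_torsion X (hol (K *m Y))) !(Lp0 _ X0) //.
rewrite {2}(hol_split (K *m Z)) {2}(hol_split (K *m Y)) !hD.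
rewrite (h0 X0 (ahol_antihol (K *m Z))) // (h0 X0 (ahol_antihol (K *m Y))) //.
ring.
Qed.

(** Let x, y be the holomorphic parts of [K X], [K Y], and x', y' the antiholomorphic ones. The
    connection terms paired with [Z] give Lp x y Z - Lp y x Z = h x y Z. With the corrections from
    [EE] this becomes - h x y Z - h x y' Z - h x' y Z, which is - h (K X) (K Y) Z because h x' y' Z
    = 0. *)
Lemma jacobi_bivector X Y Z : antihol X -> antihol Y -> antihol Z ->
  let e X Y Z := k (hol (K *m X)) Z Y + g' (hol (K *m X)) Z (K *m Y) in
  e X Y Z + e Y Z X + e Z X Y = 0.
Proof.
move=> X0 Y0 Z0 /=.
rewrite -/(E (hol (K *m X)) Z Y) -/(E (hol (K *m Y)) X Z) -/(E (hol (K *m Z)) Y X).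
rewrite !EE.
rewrite (Lp_hol _ (K *m X) Y0) (Lp_hol _ (K *m X) Z0) (Lp_hol _ (K *m Y) X0).
rewrite (Lp_hol _ (K *m Y) Z0) (Lp_hol _ (K *m Z) X0) (Lp_hol _ (K *m Z) Y0).
(* The cyclic sum turns out to be the negative of the right-hand side of this identity. *)
have := hK X Y Z; rewrite h0 // /ins2.
set x := hol (K *m X); set y := hol (K *m Y); set z := hol (K *m Z).
rewrite (hol_split (K *m X)) (hol_split (K *m Y)) (hol_split (K *m Z)).
rewrite -/x -/y -/z.
set x' := ahol _; set y' := ahol _; set z' := ahol _.
have hD1 U U' V W : h (U + U') V W = h U V W + h U' V W.
  by rewrite hswap hD !(hswap _ V); ring.
have hD3 U U' V W : h V W (U + U') = h V W U + h V W U'.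
  by rewrite hflip hD !(hflip _ W); ring.
have [x0 y0 z0] : [/\ antihol x', antihol y' & antihol z'].
  by split; apply: ahol_antihol.
clearbody x y z x' y' z'.
rewrite !(hD1, hD, hD3) (h0 x0 y0 Z0) (h0 X0 y0 z0) (h0 x0 Y0 z0).
have hcyc1 U V W : h V W U = h U V W by rewrite (hflip V U) (hswap U V) opprK.
have hcyc2 U V W : h W U V = h U V W by rewrite (hcyc1 V) (hcyc1 U).
rewrite (Lp_torsion x y) (Lp_torsion y z) (Lp_torsion z x).
rewrite (hflip x Y z) (hflip x Y z') !(hcyc1 X) (hswap x y Z) (hswap x' y Z).
rewrite !(hcyc2 x Y) !(hcyc2 x' Y) (hflip X y z) (hflip X y' z) => e.
by apply: oppr_inj; rewrite oppr0 [RHS]e; ring.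
Qed.
End PoissonAlgebra.

(* P is the Jacobian matrix of a change to coordinates in which I becomes the
   constant matrix S, and DPsym the symmetry of its second derivatives. *)
Section Nijenhuis.
Variables (F : numFieldType) (n : nat) (P I S : 'M[F]_n) (DP DI : 'I_n -> 'M[F]_n).
Hypothesis Punit : P \in unitmx.
Hypothesis PI : P *m I = S *m P.
Hypothesis DPI : forall a, DP a *m I + P *m DI a = S *m DP a.
Hypothesis DPsym : forall a b i, DP a i b = DP b i a.

Let dirm_sym (X Y : 'cV[F]_n) : dirm DP X *m Y = dirm DP Y *m X.
Proof.
apply/colP => i; rewrite /dirm !mulmx_suml !summxE.
under eq_bigr do rewrite -scalemxAl !mxE mulr_sumr.
under [RHS]eq_bigr do rewrite -scalemxAl !mxE mulr_sumr.
rewrite exchange_big; apply: eq_bigr => b _; apply: eq_bigr => a _ /=.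
by rewrite DPsym; ring.
Qed.

Let dirm_I (X Y : 'cV[F]_n) : P *m (dirm DI X *m Y) = S *m (dirm DP X *m Y) - dirm DP X *m (I *m Y).
Proof.
rewrite /dirm !mulmx_suml !mulmx_sumr -sumrB; apply: eq_bigr => a _.
rewrite -!scalemxAl -!scalemxAr -scalerBr; congr (_ *: _).
by rewrite !mulmxA -mulmxBl -DPI addrAC subrr add0r.
Qed.

(** After multiplication by the invertible [P], [dirm_I] replaces derivatives of [I] by second
    derivatives of the coordinate change, which cancel in pairs by symmetry. *)
Lemma nijenhuis_eq0 (X Y : 'cV[F]_n) :
  dirm DI (I *m X) *m Y - dirm DI (I *m Y) *m X
  - I *m dirm DI X *m Y + I *m dirm DI Y *m X = 0.
Proof.
apply: (can_inj (mulKmx Punit)); rewrite mulmx0 !mulmxDr !mulmxN.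
rewrite -!(mulmxA I) !(mulmxA P I) PI -!(mulmxA S) !dirm_I.
rewrite (dirm_sym (I *m X) (I *m Y)) (dirm_sym (I *m X)) (dirm_sym (I *m Y) X).
rewrite (dirm_sym Y X) !mulmxBr.
move: (S *m (dirm DP Y *m _)) (S *m (dirm DP X *m _)) (S *m (S *m _)) => p q r.
move: (dirm DP (I *m Y) *m _) => e.
by apply/colP => i; rewrite !mxE; ring.
Qed.
End Nijenhuis.

(** * The difference of the (1,2) and (2,1) parts as a polynomial in I *)

Section TypeDecomposition.
Variables (F : numFieldType) (n : nat) (im : F) (I : 'M[F]_n) (T : bool -> 'M[F]_n).
Variable t : 'I_n -> 'I_n -> 'I_n -> F.
Hypothesis im2 : im * im = -1.
Hypothesis TE : forall e, T e = 2%:R^-1 *: (1%:M + (if e then - im else im) *: I).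

Lemma dcform_types X Y Z :
  let f a b c := tri t (T a *m X) (T b *m Y) (T c *m Z) in
  im * ((f true false false + f false true false + f false false true)
        - (f true true false + f true false true + f false true true))
  = dcform (mulmx I) (tri t) X Y Z.
Proof.
have TW e W : T e *m W = 2%:R^-1 *: (W + (if e then - im else im) *: (I *m W)).
  by rewrite TE -scalemxAl mulmxDl mul1mx -scalemxAl.
rewrite /dcform !TW !(triZ1, triZ2, triZ3, triD1, triD2, triD3) /=.
by field: im2.
Qed.
End TypeDecomposition.

(** * Algebra of sigma_+ in a frame *)

Section SigmaAlgebra.
Variables (F : numFieldType) (n : nat) (im : F) (G J K : 'M[F]_n).
Hypothesis im2 : im * im = -1.
Hypothesis Gunit : G \in unitmx.
Hypothesis Gsym : G^T = G.
Hypothesis J2 : J *m J = - 1%:M.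
Hypothesis GJ : J^T *m G = - (G *m J).
Hypothesis GK : K^T *m G = - (G *m K).

Definition typeproj (u : F) : 'M[F]_n := 2%:R^-1 *: (1%:M + u *: J).

Local Notation P := (typeproj (- im)).
Local Notation Q := (typeproj im).
Local Notation Gi := (invmx G).

Lemma invmx_sym : Gi^T = Gi.
Proof. by rewrite trmx_inv Gsym. Qed.

Lemma skew_invmx (A : 'M[F]_n) : A^T *m G = - (G *m A) -> A *m Gi = - (Gi *m A^T).
Proof.
move=> GA; apply: (can_inj (mulKmx Gunit)); apply: (can_inj (mulmxK Gunit)).
by rewrite mulmxA mulmxKV // mulmxN mulKVmx // mulNmx GA opprK.
Qed.

(** [J] is skew for the metric, so raising an index sends (1,0)-forms to T^{0,1} and (0,1)-forms to
    T^{1,0}. *)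
Lemma typeproj_comm u : typeproj u *m Gi = Gi *m (typeproj (- u))^T.
Proof.
rewrite /typeproj trmx_scale trmx_add trmx1 trmx_scale -scalemxAl -scalemxAr.
by rewrite mulmxDl mulmxDr mul1mx mulmx1 -scalemxAl -scalemxAr skew_invmx // scaleNr scalerN.
Qed.

Lemma typeprojJ u : u * u = -1 -> typeproj (- u) *m J = u *: typeproj (- u).
Proof.
move=> u2; rewrite /typeproj -scalemxAl mulmxDl mul1mx -scalemxAl J2.
rewrite scalerA mulrC -scalerA; congr (_ *: _).
by rewrite scalerDr scalerA mulrN u2 opprK scale1r scaleNr scalerN opprK addrC.
Qed.

Lemma Jtypeproj u : J *m typeproj u = typeproj u *m J.
Proof.
by rewrite /typeproj -scalemxAl -scalemxAr mulmxDl mulmxDr mul1mx mulmx1 -scalemxAl -scalemxAr.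
Qed.

Lemma typeproj_idem : P *m P = P.
Proof.
rewrite {2}/typeproj -scalemxAr mulmxDr mulmx1 -scalemxAr typeprojJ // scalerA.
rewrite mulNr im2 opprK scale1r -[X in _ *: (X + _)]scale1r -[X in _ *: (_ + X)]scale1r.
by rewrite -scalerDl scalerA mulVf ?scale1r // pnatr_eq0.
Qed.

(** Raising the indices turns the projections [Q] into [P]. Between them [J] acts as the scalar i
    next to the left [P] and as -i next to [Gi *m P^T]; the commutator thus contributes -i - i, the
    origin of the constant. *)
Lemma raise_commutator :
  Gi *m (Q^T *m ((J *m K - K *m J)^T *m G) *m Q) *m Gi^T
  = - (2%:R * im) *: (P *m K *m Gi *m P^T).
Proof.
have -> : (J *m K - K *m J)^T *m G = G *m (K *m J - J *m K).
  rewrite trmx_add trmx_opp !trmx_mul mulmxBl -!mulmxA GJ GK !mulmxN.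
  by rewrite !mulmxA GJ GK !mulNmx !opprK mulmxBr !mulmxA.
have -> : Q^T = G *m P *m Gi.
  by rewrite -mulmxA typeproj_comm opprK mulKVmx.
rewrite invmx_sym !mulmxA mulVmx // mul1mx mulmxKV // -!mulmxA typeproj_comm !mulmxA.
have PJ := typeprojJ im2.
have QJ : Q *m J = - im *: Q.
  by have := @typeprojJ (- im); rewrite opprK mulrNN; exact.
have JP (A : 'M[F]_n) : A *m J *m Gi *m P^T = - im *: (A *m Gi *m P^T).
  by rewrite -!mulmxA -typeproj_comm (mulmxA J) Jtypeproj QJ -scalemxAl -scalemxAr.
rewrite mulmxBr !mulmxBl !mulmxA JP PJ -!scalemxAl -scalerBl.
by congr (_ *: _); ring.
Qed.

Lemma sigma_skew u :
  (u *: (P *m K *m Gi *m P^T))^T = - (u *: (P *m K *m Gi *m P^T)).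
Proof.
rewrite trmx_scale -scalerN; congr (_ *: _).
rewrite !trmx_mul trmxK invmx_sym -!mulmxA -mulmxN; congr (_ *m _).
by rewrite !mulmxA -[in RHS]mulNmx skew_invmx // opprK.
Qed.

Lemma sigma_hol u : P *m (u *: (P *m K *m Gi *m P^T)) = u *: (P *m K *m Gi *m P^T).
Proof. by rewrite -scalemxAr !mulmxA typeproj_idem. Qed.
End SigmaAlgebra.

Section ChangeOfFrame.
Variables (F : numFieldType) (n : nat) (u : F).
Variables (G J K G' J' K' A : 'M[F]_n).
Hypothesis Aunit : A \in unitmx.
Hypothesis Gunit : G \in unitmx.
Hypothesis AG : G = A^T *m G' *m A.
Hypothesis AJ : A *m J = J' *m A.
Hypothesis AK : A *m K = K' *m A.

Lemma invmx_frame : A *m invmx G *m A^T = invmx G'.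
Proof.
have G'unit : G' \in unitmx by move: Gunit; rewrite AG !unitmx_mul => /andP[/andP[]].
apply: (can_inj (mulmxK G'unit)); apply: (can_inj (mulmxK Aunit)).
by rewrite mulVmx // mul1mx -!mulmxA (mulmxA A^T) -AG mulVmx // mulmx1.
Qed.

Lemma sigma_frame v :
  v *: (typeproj J' u *m K' *m invmx G' *m (typeproj J' u)^T)
  = A *m (v *: (typeproj J u *m K *m invmx G *m (typeproj J u)^T)) *m A^T.
Proof.
suff <- : A *m (typeproj J u *m K *m invmx G *m (typeproj J u)^T) *m A^T
    = typeproj J' u *m K' *m invmx G' *m (typeproj J' u)^T.
  by move: (_ *m (typeproj J u)^T) => S; rewrite scalemxAl scalemxAr.
have AP : A *m typeproj J u = typeproj J' u *m A.
  rewrite /typeproj -scalemxAl -scalemxAr mulmxDl mulmxDr mul1mx mulmx1.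
  by rewrite -scalemxAl -scalemxAr AJ.
rewrite !mulmxA AP -(mulmxA _ A) AK -(mulmxA _ _ A^T) -trmx_mul AP trmx_mul.
by rewrite !mulmxA -(mulmxA _ A) -(mulmxA _ _ A^T) invmx_frame.
Qed.
End ChangeOfFrame.

Section SkewForms.
Variables (F : numFieldType) (n : nat) (W : 'I_n -> 'M[F]_n).
Hypothesis Wskew : forall a, (W a)^T = - W a.
Implicit Types X Y Z : 'cV[F]_n.

Let t X Y Z := tri (fun a b c => W a b c) X Y Z.

Let t_skew X Y Z : t X Z Y = - t X Y Z.
Proof.
rewrite /t !tri_mx; set S := \sum_a _; have SS : S^T = - S.
  rewrite /S (big_morph _ (@trmx_add _ _ _) (trmx0 _ _ _)) -sumrN.
  by apply: eq_bigr => a _; rewrite trmx_scale Wskew scalerN.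
have -> : Z^T *m S *m Y = - (Y^T *m S *m Z)^T.
  by rewrite !trmx_mul trmxK SS mulNmx mulmxN opprK mulmxA.
by rewrite !mxE.
Qed.

Lemma dform_swap X Y Z : tri (dform W) Y X Z = - tri (dform W) X Y Z.
Proof. by rewrite !tri_dform -!/(t _ _ _) (t_skew Y) (t_skew X) (t_skew Z); ring. Qed.

Lemma dform_flip X Y Z : tri (dform W) X Z Y = - tri (dform W) X Y Z.
Proof. by rewrite !tri_dform -!/(t _ _ _) (t_skew X) (t_skew Z) (t_skew Y); ring. Qed.
End SkewForms.

Section DzAlgebra.
Variables (F : numFieldType) (n m : nat) (im : F) (G J K : 'M[F]_n) (D : 'M[F]_(m, n)).
Variables (DG DK : 'I_n -> 'M[F]_n).
Hypothesis Gunit : G \in unitmx.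
Hypothesis Gsym : G^T = G.
Hypothesis GJ : J^T *m G = - (G *m J).
Hypothesis GK : K^T *m G = - (G *m K).
Hypothesis DGsym : forall a, (DG a)^T = DG a.
Hypothesis DJ : D *m J = im *: D.
Local Notation Gi := (invmx G).

Definition sharp j : 'cV[F]_n := Gi *m (row j D)^T.

Lemma entry_row (A : 'M[F]_n) j k :
  (D *m A *m D^T) j k = (row j D *m A *m (row k D)^T) 0 0.
Proof. by rewrite -row_mul !mxE; apply: eq_bigr => l _; rewrite !mxE. Qed.

Lemma entry_tr (A : 'M[F]_n) (u v : 'rV[F]_n) :
  (u *m A *m v^T) 0 0 = (v *m A^T *m u^T) 0 0.
Proof. by rewrite -[in LHS](trmxK (_ *m v^T)) mxE !trmx_mul trmxK mulmxA. Qed.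

Lemma sharp_antihol j : antihol im J (sharp j).
Proof.
rewrite /antihol /sharp mulmxA (skew_invmx Gunit GJ) mulNmx -mulmxA -trmx_mul.
by rewrite -row_mul DJ linearZ /= trmx_scale -scalemxAr scaleNr.
Qed.

Lemma dz_frame_entry j l :
  (D *m (K *m Gi) *m D^T) j l = - (D *m (K *m sharp j)) l 0.
Proof.
rewrite entry_row entry_tr trmx_mul invmx_sym // -(opprK (Gi *m K^T)).
rewrite -(skew_invmx Gunit GK) mulmxN mulNmx mxE; congr (- _).
by rewrite /sharp -!mulmxA -row_mul !mxE; apply: eq_bigr => k _; rewrite !mxE.
Qed.

(* The derivative of K g^-1. *)
Definition frame_der a : 'M[F]_n := DK a *m Gi - K *m (Gi *m DG a *m Gi).

(** Transposing the scalar exchanges [j] and [k]; the minus sign in the derivative of g^-1 is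
    absorbed by the skewness of K g^-1. *)
Lemma frame_der_entry a j k : (D *m frame_der a *m D^T) j k =
  ((sharp k)^T *m ((DK a)^T *m G) *m sharp j) 0 0
  + ((sharp k)^T *m DG a *m (K *m sharp j)) 0 0.
Proof.
have mxD (A B : 'M[F]_1) : A 0 0 + B 0 0 = (A + B) 0 0 by rewrite mxE.
have -> : (sharp k)^T = row k D *m Gi by rewrite /sharp trmx_mul trmxK invmx_sym.
rewrite entry_row entry_tr /frame_der trmx_add trmx_opp !trmx_mul invmx_sym // DGsym.
rewrite mxD; congr (fun_of_matrix _ 0 0); rewrite /sharp mulmxBr mulmxBl !mulmxA; congr (_ + _).
  by rewrite -(mulmxA _ G) mulmxV // mulmx1.
rewrite -(mulmxA _ Gi K^T) -[Gi *m K^T]opprK -(skew_invmx Gunit GK).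
by rewrite mulmxN mulNmx opprK !mulmxA.
Qed.

Lemma frame_der_dir (X : 'cV[F]_n) j k :
  \sum_a X a 0 * (D *m frame_der a *m D^T) j k
  = tri (fun a b c => ((DK a)^T *m G) b c) X (sharp k) (sharp j)
    + tri (fun a b c => DG a b c) X (sharp k) (K *m sharp j).
Proof.
have E (A : 'I_n -> 'M[F]_n) Y Z : tri (fun a b c => A a b c) X Y Z
    = \sum_a X a 0 * (Y^T *m A a *m Z) 0 0.
  rewrite tri_mx mulmx_sumr mulmx_suml summxE; apply: eq_bigr => a _.
  by rewrite -scalemxAr -scalemxAl mxE.
by rewrite !E -big_split; apply: eq_bigr => a _; rewrite frame_der_entry mulrDr.
Qed.
End DzAlgebra.

(** * The standard complex structure and its coordinate vectors *)

Section StandardFrame.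
Variables (F : numFieldType) (m : nat) (im : F).
Hypothesis im2 : im * im = -1.

(** For [s] = i the rows are the dz_j, for [s] = -i their conjugates. Half the transpose has as
    columns the vectors d/dzbar_j for [s] = i and d/dz_j for [s] = -i. *)
Definition dzmx (s : F) : 'M[F]_(m, m + m) := row_mx 1%:M (s *: 1%:M).
Definition stdmx : 'M[F]_(m + m) := block_mx 0 (- 1%:M) 1%:M 0.

Lemma dzmx_stdmx : dzmx im *m stdmx = im *: dzmx im.
Proof.
rewrite /dzmx /stdmx mul_row_block !mulmx0 mulmxN !mulmx1 add0r addr0 scale_row_mx.
by rewrite scalerA im2 scaleN1r.
Qed.

Lemma stdmx_dzmx : stdmx *m (dzmx im)^T = - im *: (dzmx im)^T.
Proof.
have ST : stdmx^T = - stdmx.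
  by rewrite /stdmx tr_block_mx opp_block_mx !trmx0 trmx_opp !trmx1 oppr0 opprK.
by rewrite -[stdmx]trmxK ST trmx_opp mulNmx -trmx_mul dzmx_stdmx trmx_scale scaleNr.
Qed.

Lemma stdmx_zvec l : antihol im stdmx (col l (2%:R^-1 *: (dzmx im)^T)).
Proof.
rewrite /antihol colE mulmxA -scalemxAr stdmx_dzmx scalerA [_ * - im]mulrC -scalerA.
by rewrite -!scalemxAl.
Qed.

Lemma dzmx_typeproj : dzmx im *m typeproj stdmx (- im) = dzmx im.
Proof.
rewrite /typeproj -scalemxAr mulmxDr mulmx1 -scalemxAr dzmx_stdmx scalerA mulNr im2.
rewrite opprK scale1r -[X in _ *: (X + _)]scale1r -[X in _ *: (_ + X)]scale1r.
by rewrite -scalerDl scalerA mulVf ?scale1r // pnatr_eq0.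
Qed.

(** The projection onto T^{1,0} as the sum of the d/dz_j tensor dz_j. *)
Lemma dzmx_resolution : 2%:R^-1 *: (dzmx (- im))^T *m dzmx im = typeproj stdmx (- im).
Proof.
rewrite /typeproj -scalemxAl; congr (_ *: _).
rewrite /dzmx /stdmx tr_row_mx mul_col_row !trmx_scale !trmx1 mul1mx.
rewrite scale_block_mx !scaler0 [X in _ = X + _]scalar_mx_block add_block_mx.
rewrite scalerN scaleNr opprK !add0r !addr0 mul1mx mulmx1 mulNmx -scalemxAl mul1mx.
by rewrite scalerA im2 scaleN1r opprK.
Qed.

Lemma sum_dzmx (s : F) (l : 'I_m) (q : 'I_(m + m) -> F) :
  \sum_a (2%:R^-1 *: (dzmx s)^T) a l * q a
  = 2%:R^-1 * (q (lshift m l) + s * q (rshift m l)).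
Proof.
have E1 i : (2%:R^-1 *: (dzmx s)^T) (lshift m i) l = 2%:R^-1 * (i == l)%:R.
  by rewrite mxE mxE /dzmx row_mxEl mxE eq_sym.
have E2 i : (2%:R^-1 *: (dzmx s)^T) (rshift m i) l = 2%:R^-1 * (s * (i == l)%:R).
  by rewrite mxE mxE /dzmx row_mxEr mxE mxE eq_sym.
rewrite big_split_ord /= mulrDr; congr (_ + _).
  rewrite (bigD1 l) //= big1 => [|i /negPf il]; rewrite E1 ?il ?eqxx.
    by rewrite mulr1 addr0.
  by rewrite mulr0 mul0r.
rewrite (bigD1 l) //= big1 => [|i /negPf il]; rewrite E2 ?il ?eqxx.
  by rewrite mulr1 addr0 mulrA.
by rewrite !mulr0 mul0r.
Qed.
End StandardFrame.

(** The difference g - f vanishes near [x], so it is differentiable there with differential zero,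
    and g = f + (g - f). *)
Lemma near_eq_differentiable (R : realType) (V W : normedModType R)
    (f g : V -> W) (x : V) :
  (\forall y \near x, f y = g y) -> differentiable f x -> differentiable g x.
Proof.
move=> fg df; have -> : g = f + (g - f) by rewrite addrC subrK.
apply: differentiableD => //.
have h0 : \forall y \near x, (g - f) y = 0.
  near=> y; rewrite /GRing.add /GRing.opp /=; apply/eqP; rewrite subr_eq0; apply/eqP.
  by symmetry; near: y.
have hx : (g - f) x = 0 by exact: (nbhs_singleton h0).
apply/diff_locallyP.
have E : (g - f) \o shift x = cst ((g - f) x) + (0 : V -> W) +o_ 0 id.
  apply/eqaddoP => e e0.
  move: h0; rewrite (near_shift 0 x) subr0 => h1.
  near=> y.
  have Ey : (g - f) (y + x) = 0 by near: y.
  rewrite [X in `|X|](_ : _ = 0) ?normr0 ?mulr_ge0 // ?ltW //.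
  by rewrite -[LHS]/((g - f) (y + x) - ((g - f) x + 0)) Ey hx addr0 subr0.
have D : 'd (g - f) x = 0 :> (_ -> _).
  by apply: diff_unique => //; exact: cst_continuous.
by rewrite D; split => //; exact: cst_continuous.
Unshelve. all: by end_near. Qed.

(** * Calculus of matrix-valued functions *)

Section MatrixCalculus.
Variables (R : realType) (n : nat).
Implicit Types (U : set 'rV[R]_n) (x : 'rV[R]_n) (a : 'I_n).

Lemma near_on U x (P : 'rV[R]_n -> Prop) :
  open U -> U x -> (forall y, U y -> P y) -> \forall y \near x, P y.
Proof. by move=> oU Ux UP; apply: filterS UP _; exact: open_nbhs_nbhs. Qed.

Lemma pder_local U (f g : 'rV[R]_n -> R) a x :
  open U -> U x -> (forall y, U y -> f y = g y) -> pder a f x = pder a g x.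
Proof. by move=> oU Ux fg; apply: near_eq_derive; exact: near_on fg. Qed.

Lemma pderD (f g : 'rV[R]_n -> R) a x :
  differentiable f x -> differentiable g x ->
  pder a (fun y => f y + g y) x = pder a f x + pder a g x.
Proof. by move=> df dg; rewrite /pder deriveD //; exact: diff_derivable. Qed.

Lemma pderM (f g : 'rV[R]_n -> R) a x :
  differentiable f x -> differentiable g x ->
  pder a (fun y => f y * g y) x = pder a f x * g x + f x * pder a g x.
Proof.
move=> df dg; rewrite /pder deriveM; try exact: diff_derivable.
by rewrite addrC mulrC; congr (_ + _); rewrite mulrC.
Qed.

Lemma pderN (f : 'rV[R]_n -> R) a x :
  differentiable f x -> pder a (fun y => - f y) x = - pder a f x.
Proof. by move=> df; rewrite /pder deriveN //; exact: diff_derivable. Qed.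

Lemma pder_cst (u : R) a x : pder a (fun=> u) x = 0.
Proof. exact: derive_cst. Qed.

Lemma differentiable_bigsum (I : Type) (r : seq I) (P : pred I)
    (f : I -> 'rV[R]_n -> R) x :
  (forall i, P i -> differentiable (f i) x) ->
  differentiable (fun y => \sum_(i <- r | P i) f i y) x.
Proof.
move=> df; elim: r => [|i r IH].
  by under eq_fun do rewrite big_nil; exact: differentiable_cst.
under eq_fun do rewrite big_cons; case Pi: (P i) => //.
by apply: differentiableD => //; exact: df.
Qed.

Lemma differentiable_bigprod (I : Type) (r : seq I) (P : pred I)
    (f : I -> 'rV[R]_n -> R) x :
  (forall i, P i -> differentiable (f i) x) ->
  differentiable (fun y => \prod_(i <- r | P i) f i y) x.
Proof.
move=> df; elim: r => [|i r IH].
  by under eq_fun do rewrite big_nil; exact: differentiable_cst.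
under eq_fun do rewrite big_cons; case Pi: (P i) => //.
by apply: differentiableM => //; exact: df.
Qed.

Lemma pder_bigsum (I : Type) (r : seq I) (f : I -> 'rV[R]_n -> R) a x :
  (forall i, differentiable (f i) x) ->
  pder a (fun y => \sum_(i <- r) f i y) x = \sum_(i <- r) pder a (f i) x.
Proof.
move=> df; elim: r => [|i r IH].
  by under eq_fun do rewrite big_nil; rewrite big_nil pder_cst.
under eq_fun do rewrite big_cons; rewrite big_cons pderD ?IH //.
exact: differentiable_bigsum.
Qed.

Definition mdiff p q (A : 'rV[R]_n -> 'M[R]_(p, q)) x : Prop :=
  forall i j, differentiable (fun y => A y i j) x.

Definition mder p q a (A : 'rV[R]_n -> 'M[R]_(p, q)) x : 'M[R]_(p, q) :=
  \matrix_(i, j) pder a (fun y => A y i j) x.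

Lemma mder_local p q U (A B : 'rV[R]_n -> 'M[R]_(p, q)) a x :
  open U -> U x -> (forall y, U y -> A y = B y) -> mder a A x = mder a B x.
Proof.
move=> oU Ux AB; apply/matrixP => i j; rewrite !mxE.
by apply: (pder_local _ oU Ux) => y /AB ->.
Qed.

Lemma mdiff_local p q U (A B : 'rV[R]_n -> 'M[R]_(p, q)) x :
  open U -> U x -> (forall y, U y -> A y = B y) -> mdiff A x -> mdiff B x.
Proof.
move=> oU Ux AB dA i j; apply: near_eq_differentiable (dA i j).
by apply: near_on oU Ux _ => y /AB ->.
Qed.

Lemma mder_cst p q (A : 'M[R]_(p, q)) a x : mder a (fun=> A) x = 0.
Proof. by apply/matrixP => i j; rewrite !mxE pder_cst. Qed.

Lemma mdiff_tr p q (A : 'rV[R]_n -> 'M[R]_(p, q)) x :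
  mdiff A x -> mdiff (fun y => (A y)^T) x.
Proof. by move=> dA i j; under eq_fun do rewrite mxE. Qed.

Lemma mder_tr p q (A : 'rV[R]_n -> 'M[R]_(p, q)) a x :
  mder a (fun y => (A y)^T) x = (mder a A x)^T.
Proof.
by apply/matrixP => i j; rewrite !mxE; congr pder; apply/funext => y; rewrite mxE.
Qed.

Lemma mder_opp p q (A : 'rV[R]_n -> 'M[R]_(p, q)) a x : mdiff A x ->
  mder a (fun y => - A y) x = - mder a A x.
Proof.
move=> dA; apply/matrixP => i j; rewrite !mxE; under eq_fun do rewrite mxE.
exact: pderN.
Qed.

Lemma mdiff_mul p q r (A : 'rV[R]_n -> 'M[R]_(p, q))
    (B : 'rV[R]_n -> 'M[R]_(q, r)) x :
  mdiff A x -> mdiff B x -> mdiff (fun y => A y *m B y) x.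
Proof.
move=> dA dB i j; under eq_fun do rewrite mxE.
by apply: differentiable_bigsum => k _; exact: differentiableM.
Qed.

Lemma mder_mul p q r (A : 'rV[R]_n -> 'M[R]_(p, q))
    (B : 'rV[R]_n -> 'M[R]_(q, r)) a x :
  mdiff A x -> mdiff B x ->
  mder a (fun y => A y *m B y) x = mder a A x *m B x + A x *m mder a B x.
Proof.
move=> dA dB; apply/matrixP => i j; rewrite !mxE; under eq_fun do rewrite mxE.
rewrite pder_bigsum => [|k]; last exact: differentiableM.
rewrite -big_split; apply: eq_bigr => k _.
by rewrite pderM // !mxE.
Qed.

Lemma mdiff_det p (A : 'rV[R]_n -> 'M[R]_p) x :
  mdiff A x -> differentiable (fun y => \det (A y)) x.
Proof.
move=> dA; apply: differentiable_bigsum => s _.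
apply: differentiableM; first exact: differentiable_cst.
exact: differentiable_bigprod.
Qed.

(** Cramer's rule: the inverse is the adjugate divided by the determinant, and both are polynomial
    in the entries. *)
Lemma mdiff_inv p U (A : 'rV[R]_n -> 'M[R]_p) x :
  open U -> U x -> (forall y, U y -> A y \in unitmx) ->
  mdiff A x -> mdiff (fun y => invmx (A y)) x.
Proof.
move=> oU Ux Aunit dA.
apply: (mdiff_local (A := fun y => (\det (A y))^-1 *: \adj (A y)) oU Ux).
  by move=> y Uy; rewrite /invmx Aunit.
move=> i j; under eq_fun do rewrite !mxE.
apply: differentiableM.
  apply: differentiableV; first exact: mdiff_det.
  by have := Aunit _ Ux; rewrite unitmxE unitfE.
apply: differentiableM; first exact: differentiable_cst.
by apply: mdiff_det => k l; under eq_fun do rewrite !mxE.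
Qed.

Lemma mder_inv p U (A : 'rV[R]_n -> 'M[R]_p) a x :
  open U -> U x -> (forall y, U y -> A y \in unitmx) -> mdiff A x ->
  mder a (fun y => invmx (A y)) x = - (invmx (A x) *m mder a A x *m invmx (A x)).
Proof.
move=> oU Ux Aunit dA; have dAi := mdiff_inv oU Ux Aunit dA.
have := mder_mul a dA dAi.
rewrite (mder_local (B := fun=> 1%:M) a oU Ux) ?mder_cst; last first.
  by move=> y Uy; rewrite mulmxV // Aunit.
move/(congr1 (mulmx (invmx (A x)))).
rewrite mulmx0 mulmxDr mulKmx ?Aunit // mulmxA => /eqP.
by rewrite eq_sym addrC addr_eq0 => /eqP.
Qed.

End MatrixCalculus.

(** * Symmetry of second derivatives *)

Lemma is_derive_line (R : realType) (V : normedModType R) (f : V -> R) (y u : V) (s : R) :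
  differentiable f (y + s *: u) ->
  is_derive s 1 (fun r : R => f (y + r *: u)) ('D_u f (y + s *: u)).
Proof.
move=> df; pose g (r : R) := y + r *: u.
have dg : is_diff s g ( *:%R^~ u).
  rewrite (_ : ( *:%R^~ u) = 0 + ( *:%R^~ u)); last by rewrite add0r.
  exact: (is_diffD (f := cst y)).
have dfg : differentiable (f \o g) s by apply: differentiable_comp.
apply: DeriveDef; first exact: diff_derivable.
rewrite deriveE // deriveE // (diff_comp (f := g)) //= diff_val.
by rewrite scale1r.
Qed.

(* The mean value theorem turns the mixed difference into t times an increment of
   'D_u f; the estimate is symmetric in u and v. *)
Lemma mixed_difference (R : realType) (V : normedModType R) (f : V -> R) (x u v : V) :
  (\forall y \near x, differentiable f y) -> differentiable ('D_u f) x ->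
  forall e : R, 0 < e -> \forall t \near 0^'+,
  `|f (x + t *: v + t *: u) - f (x + t *: u) - f (x + t *: v) + f x
    - t ^+ 2 * 'D_v ('D_u f) x| <= e * t ^+ 2.
Proof.
move=> df dF e e0; set F := 'D_u f in dF *.
pose M := `|u| + `|v| + 1.
have M0 : 0 < M by rewrite ltr_wpDl // addr_ge0.
(* The increments used below have norm at most t M. Each of the two error terms is then at most
   e/(2M) * t M = e t/2, and the mean value theorem supplies the second factor t. *)
have [d d0 Hd] : exists2 d : R, 0 < d & forall h : V, `|h| < d ->
    differentiable f (x + h) /\ `|F (x + h) - F x - 'd F x h| <= e / (2%:R * M) * `|h|.
  have := diff_locally dF => /eqaddoP /(_ (e / (2%:R * M))).
  rewrite divr_gt0 ?mulr_gt0 // => /(_ isT) H1.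
  have H2 : \forall h \near (0 : V), differentiable f (x + h).
    move: df; rewrite (near_shift 0 x) subr0; apply: filterS => h /=.
    by rewrite addrC.
  have [d /= d0 Hd] := nbhs_norm0P.1 (filterI H1 H2).
  exists d => // h hd; have [H3 H4] := Hd h hd.
  split => //; move: H3; rewrite /= /cst /=.
  rewrite [X in `|X|](_ : _ = F (x + h) - F x - 'd F x h) //.
  by rewrite -[LHS]/(F (h + x) - (F x + 'd F x h)) opprD addrA addrC [h + x]addrC addrC.
near=> t.
have t0 : 0 < t by near: t; exact: nbhs_right_gt.
have tM : t * M < d.
  by rewrite -ltr_pdivlMr //; near: t; apply: nbhs_right_lt; rewrite divr_gt0.
have bound s r : s \in `[0, t] -> r \in `[0, t] -> `|r *: v + s *: u| <= t * M.
  rewrite !in_itv /= => /andP[s0 st] /andP[r0 rt].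
  apply: le_trans (ler_normD _ _) _; rewrite !normrZ !ger0_norm //.
  rewrite /M !mulrDr mulr1 addrC.
  apply: (@le_trans _ _ (t * `|u| + t * `|v|)); last by rewrite lerDl ltW.
  by rewrite lerD // ler_wpM2r.
have small s r : s \in `[0, t] -> r \in `[0, t] -> `|r *: v + s *: u| < d.
  by move=> st rt; apply: le_lt_trans tM; exact: bound.
have t_in : t \in `[0, t] by rewrite in_itv /= lexx ltW.
have o_in : 0 \in `[0, t] by rewrite in_itv /= lexx ltW.
pose phi (s : R) := f (x + t *: v + s *: u) - f (x + s *: u).
have dphi s : s \in `[0, t] ->
    is_derive s 1 phi (F (x + t *: v + s *: u) - F (x + s *: u)).
  move=> st; apply: is_deriveB; apply: is_derive_line.
    by rewrite -addrA; apply: (Hd _ _).1; exact: small.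
  have /Hd[] // := small _ _ st o_in.
  by rewrite scale0r add0r.
have [|c ct E] := MVT t0 (fun s st => dphi s (subset_itv_oo_cc st)).
  apply: derivable_within_continuous => s /dphi [] //.
have {}ct : c \in `[0, t] := subset_itv_oo_cc ct.
have [_ B1] := Hd _ (small _ _ ct t_in).
have [_ B2] := Hd _ (small _ _ ct o_in).
move: E; rewrite /phi !scale0r !addr0 subr0 => E.
have Dv : 'd F x (t *: v + c *: u) - 'd F x (0 *: v + c *: u) = t * 'D_v F x.
  by rewrite scale0r add0r linearD addrK linearZ deriveE.
set h1 := t *: v + c *: u in B1 Dv; set h2 := 0 *: v + c *: u in B2 Dv.
have {}E : f (x + t *: v + t *: u) - f (x + t *: u) - f (x + t *: v) + f x
    - t ^+ 2 * 'D_v F x = t * ((F (x + h1) - F x - 'd F x h1)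
      - (F (x + h2) - F x - 'd F x h2)).
  rewrite expr2 -mulrA -Dv /h1 /h2 scale0r add0r addrA.
  by rewrite (_ : f _ - _ - _ + _ = (F (x + t *: v + c *: u) - F (x + c *: u)) * t);
    [ring | rewrite -E; ring].
rewrite E normrM gtr0_norm // expr2 mulrA [e * t]mulrC -mulrA ler_wpM2l ?(ltW t0) //.
apply: le_trans (ler_normB _ _) _; apply: le_trans (lerD B1 B2) _.
rewrite -mulrDr; apply: (@le_trans _ _ (e / (2%:R * M) * (2%:R * (t * M)))).
  by rewrite ler_wpM2l ?divr_ge0 ?mulr_ge0 ?(ltW e0) ?(ltW M0) // mulr_natl mulr2n lerD // bound.
by rewrite le_eqVlt; apply/orP; left; apply/eqP; field; rewrite gt_eqF.
Unshelve. all: by end_near. Qed.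

(** Both orders of differentiation approximate the same second difference, up to e/2 * t^2 each, so
    the two values differ by at most any e > 0. *)
Lemma derive_commute (R : realType) (V : normedModType R) (f : V -> R) (x u v : V) :
  (\forall y \near x, differentiable f y) ->
  differentiable ('D_u f) x -> differentiable ('D_v f) x ->
  'D_v ('D_u f) x = 'D_u ('D_v f) x.
Proof.
move=> df du dv; apply/eqP; rewrite -subr_eq0 -normr_le0.
apply/ler_addgt0Pr => e e0; rewrite add0r.
have e2 : 0 < e / 2%:R by rewrite divr_gt0.
have t0 : \forall t \near (0 : R)^'+, 0 < t by exact: nbhs_right_gt.
have [t [[]]] : exists t, _ := filter_ex (filterI (filterI (mixed_difference v df du e2)
  (mixed_difference u df dv e2)) t0).
set A := 'D_v _ x; set B := 'D_u _ x => H1 H2 {}t0.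
rewrite -(ler_pM2r (exprn_gt0 2 t0)) -[X in _ * X]ger0_norm ?exprn_ge0 ?(ltW t0) //.
rewrite -normrM; set a := f (x + _ + _) in H1; set b := f (x + _ + _) in H2.
have ab : a = b by rewrite /a /b addrAC.
set c := f (x + t *: u) in H1 H2; set d := f (x + t *: v) in H1 H2.
rewrite (_ : (A - B) * _ = (b - d - c + f x - t ^+ 2 * B) - (a - c - d + f x - t ^+ 2 * A)).
  by apply: le_trans (ler_normB _ _) _; apply: le_trans (lerD H2 H1) _; rewrite -mulrDl -splitr.
by rewrite ab; ring.
Qed.

Lemma pder_commute (R : realType) n (U : set 'rV[R]_n) (f : 'rV[R]_n -> R) x a b :
  open U -> U x -> smooth_on U f -> pder a (pder b f) x = pder b (pder a f) x.
Proof.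
move=> oU Ux sf; apply: derive_commute.
- by apply: near_on oU Ux _ => y Uy; exact: (sf [::]).
- exact: (sf [:: b]).
- exact: (sf [:: a]).
Qed.

(** * Tensors in charts *)

Lemma differentiable_rV (R : realType) (V : normedModType R) k (f : V -> 'rV[R]_k) x :
  (forall i, differentiable (fun y => f y 0 i) x) -> differentiable f x.
Proof.
move=> df; rewrite (_ : f = \sum_i (fun y => f y 0 i *: delta_mx 0 i)).
  apply: differentiable_sum => i; exact: differentiableZl.
by apply/funext => y; rewrite fct_sumE -row_sum_delta.
Qed.

Section Overlaps.
Variables (R : realType) (n : nat) (M : smoothManifold R n).
Implicit Types (c : chart R n M) (x : 'rV[R]_n).

Definition overlap c c' : set 'rV[R]_n := cmap c @` (cdom c `&` cdom c').

Lemma overlap_open c c' : open (overlap c c').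
Proof.
rewrite openE => _ [p [cp c'p] <-].
have ci : cimg c (cmap c p) by exists p.
have := @cinv_continuous _ _ _ c; rewrite continuous_open_subspace; last exact: cimg_open.
move=> /(_ (cmap c p)); rewrite inE => /(_ ci) cont.
have H1 : \forall y \near cmap c p, cdom c' (cinv c y).
  apply: cont; rewrite /= cmapK //; exact: open_nbhs_nbhs (conj (cdom_open c') c'p).
have H2 : \forall y \near cmap c p, cimg c y.
  by apply: open_nbhs_nbhs; split => //; exact: cimg_open.
apply: filterS (filterI H1 H2) => y [+ [q cq qy]].
by rewrite -qy cmapK // => c'q; exists q.
Qed.

Lemma tjacE c c' x i j : atlas c -> atlas c' -> overlap c c' x ->
  tjac c c' x i j = pder j (fun y => transition c c' y 0 i) x.
Proof.
move=> ac ac' xo; have [sm _] := atlas_compatible ac ac'.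
have df : differentiable (transition c c') x.
  by apply: differentiable_rV => k; exact: (sm k [::]).
have dr : derivable (transition c c') x (delta_mx 0 j) by exact: diff_derivable.
rewrite /pder mxE; have := congr1 (fun A : 'rV_n => A 0 i) (derive_mx dr).
by rewrite mxE deriveEjacobian // -rowE mxE => ->.
Qed.

End Overlaps.

(** * Complexified forms, their types and d^c *)

Section ComplexCalculus.
Variables (R : realType) (n : nat).
Local Notation C := R[i].
Local Notation iC := (Complex 0 1 : C).
Implicit Types (U : set 'rV[R]_n) (x : 'rV[R]_n).

Lemma mxCE p q (A : 'M[R]_(p, q)) : mxC A = map_mx (real_complex R) A.
Proof. by []. Qed.

Lemma mxC_E p q (A : 'M[R]_(p, q)) i j : mxC A i j = Complex (A i j) 0.
Proof. exact: mxE. Qed.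

Lemma mx0E (V : nmodType) p q i j : (0 : 'M[V]_(p, q)) i j = 0.
Proof. exact: mxE. Qed.

Lemma iC2 : iC * iC = -1.
Proof. by rewrite -[LHS]expr2 sqr_i. Qed.

Lemma pderC_local U (f g : 'rV[R]_n -> C) a x :
  open U -> U x -> (forall y, U y -> f y = g y) -> pderC a f x = pderC a g x.
Proof.
by move=> oU Ux fg; congr Complex; apply: (pder_local _ oU Ux) => y /fg ->.
Qed.

Lemma pderC_real (f : 'rV[R]_n -> R) a x :
  pderC a (fun y => Complex (f y) 0) x = Complex (pder a f x) 0.
Proof. by congr Complex; exact: pder_cst. Qed.

Lemma pderC0 a x : pderC a (fun=> 0) x = 0.
Proof. by rewrite (pderC_real (fun=> 0)) pder_cst. Qed.

Lemma extd_local U (al be : 'rV[R]_n -> 'M[C]_n) x a b c :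
  open U -> U x -> (forall y, U y -> al y = be y) ->
  extd al x a b c = extd be x a b c.
Proof.
move=> oU Ux ab; congr (_ + _ + _); apply: (pderC_local _ oU Ux) => y /ab -> //.
Qed.

Lemma extd_real (W : 'rV[R]_n -> 'M[R]_n) x a b c :
  extd (fun y => mxC (W y)) x a b c = dform (fun a => mxC (mder a W x)) a b c.
Proof.
have E d p q : pderC d (fun y => mxC (W y) p q) x = mxC (mder d W x) p q.
  rewrite mxC_E /mder (mxE _ (fun i j => pder d (fun y => W y i j) x)) -pderC_real.
  by congr pderC; apply/funext => y; exact: mxC_E.
by rewrite /extd /dform !E.
Qed.

Lemma extd0 x a b c : extd (fun=> 0) x a b c = 0 :> C.
Proof.
have E d p q : pderC d (fun=> (0 : 'M[C]_n) p q) x = 0.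
  by rewrite (_ : (fun=> _) = fun=> 0) ?pderC0 //; apply/funext => y; exact: mx0E.
by rewrite /extd !E !addr0.
Qed.

Lemma sum_pair (V : nmodType) (S T : finType) (f : S * T -> V) :
  \sum_e f e = \sum_a \sum_b f (a, b).
Proof.
rewrite (pair_bigA _ (fun a b => f (a, b))) /=; apply: eq_bigr => e _.
by case: e.
Qed.

(** The default value 0 of [nth] covers [p] > 2, where the sum is empty. *)
Lemma sum_type2 (V : nmodType) p (f : bool -> bool -> V) :
  \sum_(e : bool * bool | (e.1 + e.2 == p)%N) f e.1 e.2
  = nth 0 [:: f false false; f true false + f false true; f true true] p.
Proof.
rewrite big_mkcond sum_pair !big_bool /=.
by case: p => [|[|[|p]]] /=; rewrite ?addr0 ?add0r // nth_nil.
Qed.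

Lemma sum_type3 (V : nmodType) p (f : bool -> bool -> bool -> V) :
  \sum_(e : bool * bool * bool | (e.1.1 + e.1.2 + e.2 == p)%N) f e.1.1 e.1.2 e.2
  = nth 0 [:: f false false false;
      f true false false + f false true false + f false false true;
      f true true false + f true false true + f false true true;
      f true true true] p.
Proof.
rewrite big_mkcond sum_pair sum_pair !big_bool /=.
by case: p => [|[|[|[|p]]]] /=; rewrite ?addr0 ?add0r ?addrA // nth_nil.
Qed.

Lemma sum_ord3_1 (V : nmodType) (g : nat -> V) :
  (forall p, p != 1%N -> g p = 0) -> \sum_(p < 3) g p = g 1%N.
Proof.
move=> g0; rewrite (bigD1 (Ordinal (isT : (1 < 3)%N))) //= big1 ?addr0 //.
by move=> p p1; apply: g0; apply: contra p1 => /eqP p1; apply/eqP/val_inj.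
Qed.

Lemma tri_type3 (A : 'M[R]_n) p (be : 'I_n -> 'I_n -> 'I_n -> C) X Y Z :
  tri (type3 A p be) X Y Z =
  \sum_(e : bool * bool * bool | (e.1.1 + e.1.2 + e.2 == p)%N)
    tri be (tproj A e.1.1 *m X) (tproj A e.1.2 *m Y) (tproj A e.2 *m Z).
Proof.
under eq_bigr do rewrite -tri_sub.
rewrite /tri [RHS]exchange_big; apply: eq_bigr => i _ /=.
rewrite [RHS]exchange_big; apply: eq_bigr => j _ /=.
rewrite [RHS]exchange_big; apply: eq_bigr => k _ /=.
by rewrite /type3 !mulr_suml.
Qed.

Section Hermitian.
Variables (A : 'M[R]_n) (W : 'M[C]_n).
Hypothesis A2 : A *m A = - 1%:M.
Hypothesis AW : (mxC A)^T *m W = - (W *m mxC A).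

Let AA : mxC A *m mxC A = - 1%:M.
Proof. by rewrite !mxCE -map_mxM A2 map_mxN map_mx1. Qed.

Lemma tproj_sum : tproj A true + tproj A false = 1%:M.
Proof.
rewrite /tproj -scalerDr scaleNr addrACA addNr addr0.
rewrite -[X in _ *: (X + _)]scale1r -[X in _ *: (_ + X)]scale1r -scalerDl.
by rewrite scalerA mulVf ?scale1r // pnatr_eq0.
Qed.

(** By [AW] both eigenspaces of [A] are isotropic for [W]: moving [A] from one argument to the other
    changes the sign of an equal eigenvalue. *)
Let type2_diag e : (tproj A e)^T *m W *m tproj A e = 0.
Proof.
have E s : s * s = -1 -> (1%:M + s *: mxC A)^T *m W *m (1%:M + s *: mxC A) = 0.
  move=> s2; rewrite trmx_add trmx1 trmx_scale mulmxDl mul1mx -scalemxAl AW.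
  rewrite scalerN mulmxDr mulmx1 mulmxBl -scalemxAr -scalemxAl -!mulmxA.
  rewrite -!scalemxAr AA mulmxN mulmx1 !scalerN opprK scalerA s2 scaleN1r.
  by rewrite addrA subrK subrr.
rewrite /tproj trmx_scale -!scalemxAl -scalemxAr E ?scaler0 //.
by case: e; rewrite ?mulrNN iC2.
Qed.

Lemma type2_11 p : type2 A p W = if p == 1%N then W else 0.
Proof.
rewrite /type2 (sum_type2 p (fun a b => (tproj A a)^T *m W *m tproj A b)).
move: (type2_diag true) (type2_diag false) tproj_sum.
move: (tproj A true) (tproj A false) => P Q P0 Q0 PQ; rewrite P0 Q0.
have E : (P + Q)^T *m W *m (P + Q) = W by rewrite PQ trmx1 mul1mx mulmx1.
case: p => [|[|[|p]]] //=; last by rewrite nth_nil.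
by rewrite -[RHS]E trmx_add mulmxDr !mulmxDl P0 Q0 add0r addr0 addrC.
Qed.
End Hermitian.

Lemma type3_0 (A : 'M[R]_n) p (be : 'I_n -> 'I_n -> 'I_n -> C) a b c :
  (forall i j k, be i j k = 0) -> type3 A p be a b c = 0.
Proof.
move=> be0; rewrite /type3 big1 // => e _; rewrite big1 // => i _.
by rewrite big1 // => j _; rewrite big1 // => k _; rewrite be0 !mul0r.
Qed.

Lemma eq_type3 (A : 'M[R]_n) p (be be' : 'I_n -> 'I_n -> 'I_n -> C) a b c :
  (forall i j k, be i j k = be' i j k) -> type3 A p be a b c = type3 A p be' a b c.
Proof.
move=> E; apply: eq_bigr => e _; apply: eq_bigr => i _.
by apply: eq_bigr => j _; apply: eq_bigr => k _; rewrite E.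
Qed.

Lemma dc_type11 U (A : 'rV[R]_n -> 'M[R]_n) (al : 'rV[R]_n -> 'M[C]_n) x a b c :
  open U -> U x -> (forall y, U y -> A y *m A y = - 1%:M) ->
  (forall y, U y -> (mxC (A y))^T *m al y = - (al y *m mxC (A y))) ->
  dc A al x a b c
  = iC * (type3 (A x) 1 (extd al x) a b c - type3 (A x) 2 (extd al x) a b c).
Proof.
move=> oU Ux A2 Aal.
have E p i j k : extd (fun y => type2 (A y) p (al y)) x i j k
    = if p == 1%N then extd al x i j k else 0.
  case: ifP => [/eqP ->|p1].
    by apply: (extd_local _ _ _ oU Ux) => y Uy; rewrite type2_11 ?A2 ?Aal.
  rewrite -(extd0 x i j k).
  by apply: (extd_local _ _ _ oU Ux) => y Uy; rewrite type2_11 ?A2 ?Aal ?p1.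
(* The shift [q] is 0 for delbar and 1 for del; in both sums only the (1,1) part of the form
   survives. *)
have D q : \sum_(p < 3) type3 (A x) (q + p) (extd (fun y => type2 (A y) p (al y)) x) a b c
    = type3 (A x) (q + 1) (extd al x) a b c.
  rewrite (sum_ord3_1 (g := fun p => type3 (A x) (q + p)
    (extd (fun y => type2 (A y) p (al y)) x) a b c)).
    by apply: eq_type3 => i j k; rewrite E.
  by move=> p p1; apply: type3_0 => i j k; rewrite E (negbTE p1).
by rewrite /dc /delbar (D 0%N) /del (D 1%N).
Qed.

Lemma tri_dc U (A : 'rV[R]_n -> 'M[R]_n) (al : 'rV[R]_n -> 'M[C]_n) x X Y Z :
  open U -> U x -> (forall y, U y -> A y *m A y = - 1%:M) ->
  (forall y, U y -> (mxC (A y))^T *m al y = - (al y *m mxC (A y))) ->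
  tri (dc A al x) X Y Z = dcform (mulmx (mxC (A x))) (tri (extd al x)) X Y Z.
Proof.
move=> oU Ux A2 Aal; rewrite (eq_tri _ _ _ (fun a b c => dc_type11 a b c oU Ux A2 Aal)).
have -> : tri (fun a b c => iC * (type3 (A x) 1 (extd al x) a b c
    - type3 (A x) 2 (extd al x) a b c)) X Y Z
  = iC * (tri (type3 (A x) 1 (extd al x)) X Y Z
    - tri (type3 (A x) 2 (extd al x)) X Y Z).
  transitivity (iC * tri (type3 (A x) 1 (extd al x)) X Y Z
    + tri (fun a b c => - iC * type3 (A x) 2 (extd al x) a b c + 0) X Y Z).
    by rewrite -tri_lin0; apply: eq_tri => a b c; ring.
  have -> : tri (fun a b c => - iC * type3 (A x) 2 (extd al x) a b c + 0) X Y Z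
     = - iC * tri (type3 (A x) 2 (extd al x)) X Y Z + tri (fun=> fun=> fun=> 0) X Y Z.
    exact: tri_lin0.
  have -> : tri (fun _ _ _ => 0) X Y Z = 0 :> C.
    by rewrite /tri big1 // => i _; rewrite big1 // => j _; rewrite big1 // => k _; rewrite !mul0r.
  ring.
pose f p q r := tri (extd al x) (tproj (A x) p *m X) (tproj (A x) q *m Y)
  (tproj (A x) r *m Z).
by rewrite !tri_type3 (sum_type3 1 f) (sum_type3 2 f) -(dcform_types _ iC2 (T := tproj (A x))).
Qed.
End ComplexCalculus.

(** * Hermitian structures in arbitrary charts *)

Section HermitianChart.
Variables (R : realType) (m : nat) (M : smoothManifold R (m + m)).
Variables (g : riemannian_metric M).
Local Notation n := (m + m)%N.
Implicit Types (c : chart R n M) (x : 'rV[R]_n) (p : M).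

Lemma open_cimg c : open (cimg c).
Proof. exact: cimg_open. Qed.

Lemma metric_unit c x : atlas c -> cimg c x -> g c x \in unitmx.
Proof.
move=> ac Ux; rewrite -row_free_unit -kermx_eq0; apply/negPn/negP => k0.
have v0 : (nz_row (kermx (g c x)))^T != 0.
  by rewrite -(inj_eq (@trmx_inj _ _ _)) trmxK trmx0 nz_row_eq0.
have := metric_pos g ac Ux v0.
by rewrite trmxK (sub_kermxP (nz_row_sub _)) mul0mx mxE ltxx.
Qed.

Lemma metric_diff c x : atlas c -> cimg c x -> mdiff (g c) x.
Proof. by move=> ac Ux i j; exact: (metric_smooth g ac i j [::]). Qed.

Lemma tjac_unit c c' p : atlas c -> atlas c' -> cdom c p -> cdom c' p ->
  tjac c c' (cmap c p) \in unitmx.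
Proof.
move=> ac ac' cp c'p.
have := metric_unit ac (ex_intro2 _ _ p cp erefl).
by rewrite (metric_law g ac ac' cp c'p) !unitmx_mul => /andP[].
Qed.

Variable A : complex_structure M.

Lemma cstr_diff c x : atlas c -> cimg c x -> mdiff (A c) x.
Proof. by move=> ac Ux i j; exact: (cstr_smooth A ac i j [::]). Qed.

Lemma cstr_mder c x a : atlas c -> cimg c x ->
  mder a (A c) x *m A c x + A c x *m mder a (A c) x = 0.
Proof.
move=> ac Ux; have dA := cstr_diff ac Ux.
rewrite -mder_mul // (mder_local (B := fun=> - 1%:M) a (@open_cimg c) Ux) ?mder_cst //.
by move=> y Uy; exact: cstr_sq.
Qed.

(** Near the point, integrability supplies a chart in which the structure is constant. The Jacobian
    [Phi] of the change to that chart intertwines the two matrices on the overlap, which is open, so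
    the relation may be differentiated and [nijenhuis_eq0] applies. *)
Lemma cstr_nijenhuis c x (X Y : 'cV[R[i]]_n) : atlas c -> cimg c x ->
  let I := mxC (A c x) in let DI a := mxC (mder a (A c) x) in
  dirm DI (I *m X) *m Y - dirm DI (I *m Y) *m X
  - I *m dirm DI X *m Y + I *m dirm DI Y *m X = 0.
Proof.
move=> ac [p cp <-] /=; set x0 := cmap c p.
have [c' [ac' Astd] c'p] := cstr_integrable A p.
have Ox : overlap c c' x0 by exists p.
have oO := @overlap_open _ _ M c c'.
have [sm _] := atlas_compatible ac ac'.
pose Phi := tjac c c'.
have PhiE y i j : overlap c c' y ->
    pder j (fun y => transition c c' y 0 i) y = Phi y i j.
  by move=> Oy; rewrite /Phi tjacE.
have dPhi : mdiff Phi x0.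
  move=> i j; apply: near_eq_differentiable (sm i [:: j] x0 Ox).
  by apply: near_on oO Ox _ => y Oy; exact: PhiE.
(* The entries of [Phi] are first derivatives of the transition map, so this is the symmetry of its
   second derivatives. *)
have Phi_sym a b i : mder a Phi x0 i b = mder b Phi x0 i a.
  have E k l : mder k Phi x0 i l = pder k (pder l (fun y => transition c c' y 0 i)) x0.
    rewrite mxE; symmetry; apply: (pder_local k oO Ox) => y Oy; exact: PhiE.
  have H := pder_commute a b oO Ox (sm i).
  apply: etrans (E a b) _.
  apply: etrans _ (esym (E b a)).
  exact: H.
have PhiA y : overlap c c' y -> Phi y *m A c y = stdJ R m *m Phi y.
  move=> [q [cq c'q] <-]; rewrite (cstr_law A ac ac' cq c'q) Astd //.
  by exists q.
apply: (nijenhuis_eq0 (P := mxC (Phi x0)) (S := mxC (stdJ R m))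
  (DP := fun a => mxC (mder a Phi x0))).
- by rewrite mxCE map_unitmx; exact: tjac_unit.
- by rewrite !mxCE -!map_mxM PhiA.
- move=> a; rewrite !mxCE -!map_mxM -map_mxD; congr map_mx.
  have dA : mdiff (A c) x0 by apply: cstr_diff => //; exists p.
  rewrite -mder_mul // (mder_local _ oO Ox PhiA) mder_mul ?mder_cst ?mul0mx ?add0r //.
- move=> a b i; apply: etrans (mxC_E _ _ _) _; apply: etrans _ (esym (mxC_E _ _ _)).
  exact: (congr1 (fun t : R => Complex t 0) (Phi_sym a b i)).
Qed.

Hypothesis orth : forall c x, atlas c -> cimg c x ->
  (A c x)^T *m g c x *m A c x = g c x.

Lemma orth_skew c x : atlas c -> cimg c x ->
  (A c x)^T *m g c x = - (g c x *m A c x).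
Proof.
move=> ac Ux; rewrite -[in RHS](orth ac Ux) -!mulmxA cstr_sq //.
by rewrite !mulmxN mulmx1 opprK.
Qed.

Lemma mder_lower c x a : atlas c -> cimg c x ->
  mxC (mder a (fun y => lower (g c y) (A c y)) x)
  = domega (mxC (g c x)) (mxC (A c x)) (fun a => mxC (mder a (g c) x))
      (fun a => mxC (mder a (A c) x)) a.
Proof.
move=> ac Ux; have dA := cstr_diff ac Ux; have dg := metric_diff ac Ux.
rewrite mder_mul //; last exact: mdiff_tr.
by rewrite mder_tr /domega !mxCE map_mxD !map_mxM !map_trmx.
Qed.

Lemma lower_skew c x : atlas c -> cimg c x ->
  (lower (g c x) (A c x))^T = - lower (g c x) (A c x).
Proof.
move=> ac Ux; rewrite /lower trmx_mul trmxK (Defs.metric_sym g ac Ux).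
by rewrite orth_skew // opprK.
Qed.

Section AtPoint.
Variables (c : chart R n M) (x : 'rV[R]_n).
Hypotheses (ac : atlas c) (Ux : cimg c x).
Let G := mxC (g c x).
Let I := mxC (A c x).
Let DG a := mxC (mder a (g c) x).
Let DI a := mxC (mder a (A c) x).
Let om y := mxC (lower (g c y) (A c y)).

Lemma tri_dc_lower X Y Z : tri (dc (A c) om x) X Y Z
  = dcform (mulmx I) (tri (dform (domega G I DG DI))) X Y Z.
Proof.
rewrite (tri_dc _ _ _ (@open_cimg c) Ux); last 2 first.
- by move=> y Uy; exact: cstr_sq.
- move=> y Uy; rewrite /om /lower !mxCE map_trmx -!map_mxM -map_mxN; congr map_mx.
  by rewrite mulmxA -trmx_mul cstr_sq // trmx_opp trmx1 mulNmx mul1mx orth.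
have E X' Y' Z' : tri (extd om x) X' Y' Z' = tri (dform (domega G I DG DI)) X' Y' Z'.
  apply: eq_tri => i j k; rewrite extd_real.
  by congr (_ + _ + _); rewrite (mder_lower _ ac Ux).
by rewrite /dcform !E.
Qed.

Let I2 : I *m I = - 1%:M.
Proof. by rewrite /I !mxCE -map_mxM cstr_sq // map_mxN map_mx1. Qed.

Let Gsym : G^T = G.
Proof. by rewrite /G mxCE map_trmx Defs.metric_sym. Qed.

Let GI : I^T *m G = - (G *m I).
Proof. by rewrite /G /I !mxCE map_trmx -!map_mxM -map_mxN orth_skew. Qed.

Let DGsym a : (DG a)^T = DG a.
Proof.
rewrite /DG mxCE map_trmx -mder_tr (mder_local (B := g c) a (@open_cimg c) Ux) //.
by move=> y Uy; rewrite Defs.metric_sym.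
Qed.

Let DI2 a : DI a *m I + I *m DI a = 0.
Proof. by rewrite /I /DI !mxCE -!map_mxM -map_mxD cstr_mder // map_mx0. Qed.

Let DWskew a : (domega G I DG DI a)^T = - domega G I DG DI a.
Proof.
have dl : mdiff (fun y => lower (g c y) (A c y)) x.
  apply: mdiff_mul (metric_diff ac Ux); exact: mdiff_tr (cstr_diff ac Ux).
rewrite -mder_lower // mxCE map_trmx -map_mxN -mder_tr -mder_opp //.
by congr map_mx; apply: (mder_local a (@open_cimg c) Ux) => y Uy; rewrite lower_skew.
Qed.

Lemma nabla_dc X Y Z : 2%:R * nabla G I DG DI X Y Z
  = tri (dc (A c) om x) X (I *m Y) Z + tri (dc (A c) om x) X Y (I *m Z).
Proof.
rewrite !tri_dc_lower; apply: nabla_dcform => // X' Y'.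
exact: cstr_nijenhuis.
Qed.

Lemma dc_ins2 X Y Z : tri (dc (A c) om x) X Y Z
  = ins2 (mulmx I) (tri (dc (A c) om x)) X Y Z.
Proof.
rewrite /ins2 !tri_dc_lower; apply: dcform_domega_ins2 => // X' Y'.
exact: cstr_nijenhuis.
Qed.

End AtPoint.
End HermitianChart.

(** * The bivector field of a bihermitian structure *)

Section Sigma.
Variables (R : realType) (m : nat) (M : smoothManifold R (m + m)) (B : bihermitian M).
Local Notation n := (m + m)%N.
Local Notation C := R[i].
Local Notation iC := (Complex 0 1 : C).
Implicit Types (c : chart R n M) (x : 'rV[R]_n) (p : M).

Lemma tprojE (A : 'M[R]_n) e : tproj A e = typeproj (mxC A) (if e then - iC else iC).
Proof. by []. Qed.

Lemma type2_02 (A : 'M[R]_n) (W : 'M[C]_n) :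
  type2 A 0 W = (tproj A false)^T *m W *m tproj A false.
Proof. exact: (sum_type2 0 (fun a b => (tproj A a)^T *m W *m tproj A b)). Qed.

Section AtPoint.
Variables (c : chart R n M) (x : 'rV[R]_n).
Hypotheses (ac : atlas c) (Ux : cimg c x).
Let G := mxC (bh_g B c x).
Let J := mxC (bh_Ip B c x).
Let K := mxC (bh_Im B c x).

Lemma mxC_unit : G \in unitmx.
Proof. by rewrite /G mxCE map_unitmx metric_unit. Qed.

Lemma mxC_sym : G^T = G.
Proof. by rewrite /G mxCE map_trmx Defs.metric_sym. Qed.

Lemma mxC_sq (A : complex_structure M) : mxC (A c x) *m mxC (A c x) = - 1%:M.
Proof. by rewrite !mxCE -map_mxM cstr_sq // map_mxN map_mx1. Qed.

Lemma mxC_skewp : J^T *m G = - (G *m J).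
Proof.
rewrite /G /J !mxCE map_trmx -!map_mxM -map_mxN orth_skew //.
exact: bh_Ip_orth.
Qed.

Lemma mxC_skewm : K^T *m G = - (G *m K).
Proof.
rewrite /G /K !mxCE map_trmx -!map_mxM -map_mxN orth_skew //.
exact: bh_Im_orth.
Qed.

Lemma sigma_plusE : sigma_plus B c x = - (2%:R * iC) *:
  (tproj (bh_Ip B c x) true *m K *m invmx G *m (tproj (bh_Ip B c x) true)^T).
Proof.
have E := raise_commutator (iC2 R) mxC_unit mxC_sym (mxC_sq (bh_Ip B)) mxC_skewp mxC_skewm.
have HS : mxC (S_form B c x) = (J *m K - K *m J)^T *m G.
  by rewrite /S_form /lower mxCE map_mxM -map_trmx map_mxB !map_mxM.
have HG : mxC (invmx (bh_g B c x)) = invmx G by rewrite mxCE map_invmx.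
have -> : sigma_plus B c x = invmx G *m type2 (bh_Ip B c x) 0 (mxC (S_form B c x))
    *m (invmx G)^T by rewrite -HG.
rewrite type2_02 HS (tprojE _ true) (tprojE _ false).
exact: E.
Qed.

End AtPoint.

Lemma sigma_plus_law : bivector_law (sigma_plus B).
Proof.
move=> c c' ac ac' p cp c'p.
have Uc : cimg c (cmap c p) by exists p.
have Uc' : cimg c' (cmap c' p) by exists p.
rewrite (sigma_plusE ac Uc) (sigma_plusE ac' Uc') (tprojE (bh_Ip B c _)) tprojE.
apply: sigma_frame.
- by rewrite mxCE map_unitmx; exact: (tjac_unit (bh_g B)).
- exact: mxC_unit.
- by rewrite !mxCE map_trmx -!map_mxM; congr map_mx; exact: metric_law.
- by rewrite !mxCE -!map_mxM; congr map_mx; exact: cstr_law.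
- by rewrite !mxCE -!map_mxM; congr map_mx; exact: cstr_law.
Qed.

Lemma sigma_plus_section : section_L2T10 (bh_Ip B) (sigma_plus B).
Proof.
split=> [|c x ac Ux]; first exact: sigma_plus_law.
rewrite (sigma_plusE ac Ux) tprojE; split.
  apply: sigma_skew; [exact: mxC_unit | exact: mxC_sym | exact: mxC_skewm].
apply: sigma_hol; [exact: iC2 | exact: mxC_sq].
Qed.
End Sigma.

Section LinearEntries.
Variables (R : realType) (n p q r s : nat).
Local Notation C := R[i].
Variables (D : 'M[C]_(p, q)) (E : 'M[C]_(r, s)).

(** [u] stands for the real or the imaginary part. As [D] and [E] are constant, both parts of an
    entry of D W E are real linear combinations of the entries of [W], and [pderC] reduces to real
    derivatives. *)
Let lin (u : C -> R) (W : 'M[R]_(q, r)) i j : R :=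
  \sum_k \sum_l u (D i l * E k j) * W l k.

Lemma mulmx_real_entry (W : 'M[R]_(q, r)) i j :
  (D *m mxC W *m E) i j = Complex (lin (@complex.Re R) W i j) (lin (@complex.Im R) W i j).
Proof.
have ReD : {morph @complex.Re R : x y / x + y} by move=> [? ?] [? ?].
have ImD : {morph @complex.Im R : x y / x + y} by move=> [? ?] [? ?].
have eta (z : C) : z = Complex (complex.Re z) (complex.Im z) by case: z.
have -> : (D *m mxC W *m E) i j = \sum_k \sum_l D i l * E k j * Complex (W l k) 0.
  rewrite mxE; apply: eq_bigr => k _; rewrite mxE mulr_suml; apply: eq_bigr => l _.
  by rewrite mxC_E mulrAC.
rewrite [LHS]eta; congr Complex; rewrite /lin.
  rewrite (big_morph _ ReD (erefl : complex.Re 0 = 0)); apply: eq_bigr => k _.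
  rewrite (big_morph _ ReD (erefl : complex.Re 0 = 0)); apply: eq_bigr => l _.
  by case: (D i l * E k j) => a b /=; rewrite mulr0 subr0.
rewrite (big_morph _ ImD (erefl : complex.Im 0 = 0)); apply: eq_bigr => k _.
rewrite (big_morph _ ImD (erefl : complex.Im 0 = 0)); apply: eq_bigr => l _.
by case: (D i l * E k j) => a b /=; rewrite mulr0 add0r.
Qed.

Variables (W : 'rV[R]_n -> 'M[R]_(q, r)) (x : 'rV[R]_n).
Hypothesis dW : mdiff W x.

Let lin_diff u i j : differentiable (fun y => lin u (W y) i j) x.
Proof.
apply: differentiable_bigsum => k _; apply: differentiable_bigsum => l _.
by apply: differentiableM => //; exact: differentiable_cst.
Qed.

Let lin_pder u a i j : pder a (fun y => lin u (W y) i j) x = lin u (mder a W x) i j.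
Proof.
have dt k l : differentiable (fun y => u (D i l * E k j) * W y l k) x.
  by apply: differentiableM => //; exact: differentiable_cst.
rewrite pder_bigsum => [|k]; last by apply: differentiable_bigsum => l _.
apply: eq_bigr => k _; rewrite pder_bigsum //; apply: eq_bigr => l _.
rewrite pderM; [|exact: differentiable_cst|exact: dW].
by rewrite pder_cst mul0r add0r mxE.
Qed.

Lemma pderC_mulmx a i j :
  pderC a (fun y => (D *m mxC (W y) *m E) i j) x = (D *m mxC (mder a W x) *m E) i j.
Proof.
rewrite mulmx_real_entry; congr Complex; rewrite -lin_pder; congr pder.
  by apply/funext => y; rewrite mulmx_real_entry.
by apply/funext => y; rewrite mulmx_real_entry.
Qed.

Lemma differentiable_mulmx i j :
  differentiable (fun y => complex.Re ((D *m mxC (W y) *m E) i j)) x /\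
  differentiable (fun y => complex.Im ((D *m mxC (W y) *m E) i j)) x.
Proof.
split.
  rewrite (_ : (fun y => _) = fun y => lin (@complex.Re R) (W y) i j) //.
  by apply/funext => y; rewrite mulmx_real_entry.
rewrite (_ : (fun y => _) = fun y => lin (@complex.Im R) (W y) i j) //.
by apply/funext => y; rewrite mulmx_real_entry.
Qed.
End LinearEntries.

(** * Holomorphy and the Schouten bracket in a holomorphic chart *)

Section Poisson.
Variables (R : realType) (m : nat) (M : smoothManifold R (m + m)) (B : bihermitian M).
Local Notation n := (m + m)%N.
Local Notation C := R[i].
Local Notation iC := (Complex 0 1 : C).
Variable c : chart R n M.
Hypothesis hc : holomorphic_chart (bh_Ip B) c.
Let ac : atlas c := hc.1.

Lemma mxC_stdJ : mxC (stdJ R m) = stdmx C m.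
Proof. by rewrite mxCE /stdJ map_block_mx map_mxN !map_mx0 !map_mx1. Qed.

(* In a holomorphic chart the projection P drops out of zcomp, since dz P = dz. *)
Definition frame y : 'M[R]_n := bh_Im B c y *m invmx (bh_g B c y).

Lemma zcompE y : cimg c y -> zcomp (sigma_plus B) c y
  = (- (2%:R * iC) *: dz R m) *m mxC (frame y) *m (dz R m)^T.
Proof.
move=> Uy; rewrite /zcomp (sigma_plusE B ac Uy) tprojE (hc.2 y Uy) mxC_stdJ.
have -> : dz R m = dzmx m iC by [].
have P := dzmx_typeproj m (iC2 R).
have -> : mxC (frame y) = mxC (bh_Im B c y) *m invmx (mxC (bh_g B c y)).
  by rewrite /frame !mxCE map_mxM map_invmx.
move: (mxC (bh_Im B c y)) (invmx _) (dzmx m iC) (typeproj _ _) P => K Gi D P DP.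
by rewrite -scalemxAr -!scalemxAl !mulmxA DP -(mulmxA _ P^T) -trmx_mul DP.
Qed.

Section AtPoint.
Variable x : 'rV[R]_n.
Hypothesis Ux : cimg c x.
Let G := mxC (bh_g B c x).
Let J := mxC (bh_Ip B c x).
Let K := mxC (bh_Im B c x).
Let DG a := mxC (mder a (bh_g B c) x).
Let DK a := mxC (mder a (bh_Im B c) x).
Let oU : open (cimg c) := @open_cimg R m M c.

Let JE : J = stdmx C m.
Proof. by rewrite /J (hc.2 x Ux) mxC_stdJ. Qed.

Let g_unit y : cimg c y -> bh_g B c y \in unitmx.
Proof. exact: metric_unit. Qed.

Let frame_diff : mdiff frame x.
Proof.
apply: mdiff_mul; first exact: cstr_diff.
exact: (mdiff_inv oU Ux g_unit (metric_diff (bh_g B) ac Ux)).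
Qed.

Let frame_mder a : mxC (mder a frame x) = frame_der G K DG DK a.
Proof.
have dg := metric_diff (bh_g B) ac Ux.
rewrite mder_mul; [|exact: cstr_diff|exact: (mdiff_inv oU Ux g_unit dg)].
rewrite (mder_inv a oU Ux g_unit dg) mulmxN /frame_der !mxCE map_mxB !map_mxM.
by rewrite !map_invmx.
Qed.

Lemma zcomp_diff i j :
  differentiable (fun y => complex.Re (zcomp (sigma_plus B) c y i j)) x /\
  differentiable (fun y => complex.Im (zcomp (sigma_plus B) c y i j)) x.
Proof.
have [d1 d2] := differentiable_mulmx (- (2%:R * iC) *: dz R m) (dz R m)^T frame_diff i j.
split; [apply: near_eq_differentiable d1|apply: near_eq_differentiable d2];
  by apply: near_on oU Ux _ => y Uy; rewrite zcompE.
Qed.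

Lemma zcomp_pder a j k : pderC a (fun y => zcomp (sigma_plus B) c y j k) x
  = - (2%:R * iC) * (dz R m *m frame_der G K DG DK a *m (dz R m)^T) j k.
Proof.
rewrite (pderC_local (g := fun y => ((- (2%:R * iC) *: dz R m) *m mxC (frame y)
  *m (dz R m)^T) j k) a oU Ux); last by move=> y Uy; rewrite zcompE.
rewrite (pderC_mulmx _ _ frame_diff) frame_mder.
move: (frame_der _ _ _ _ _) (dz R m) => W D.
by rewrite -!scalemxAl mxE.
Qed.

Let h X Y Z := tri (extd (fun y => mxC (bh_b B c y)) x) X Y Z.
Let L X Y Z := tri (chris DG) X Y Z.
Let k X Y Z := tri (fun a b c => ((DK a)^T *m G) b c) X Y Z.
Let g' X Y Z := tri (fun a b c => DG a b c) X Y Z.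

Let DGsym a : (DG a)^T = DG a.
Proof.
rewrite /DG mxCE map_trmx -mder_tr (mder_local (B := bh_g B c) a oU Ux) //.
by move=> y Uy; rewrite Defs.metric_sym.
Qed.

Let Dbskew a : (mxC (mder a (bh_b B c) x))^T = - mxC (mder a (bh_b B c) x).
Proof.
have db : mdiff (bh_b B c) x by move=> i j; exact: (tform_smooth (bh_b B) ac i j [::]).
rewrite mxCE map_trmx -map_mxN -mder_tr -mder_opp //; congr map_mx.
by apply: (mder_local a oU Ux) => y Uy; rewrite tform_skew.
Qed.

Let hE X Y Z : h X Y Z = tri (dform (fun a => mxC (mder a (bh_b B c) x))) X Y Z.
Proof. by apply: eq_tri => i j l; exact: extd_real. Qed.

Let hswap X Y Z : h Y X Z = - h X Y Z.
Proof. by rewrite !hE dform_swap. Qed.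

Let hflip X Y Z : h X Z Y = - h X Y Z.
Proof. by rewrite !hE dform_flip. Qed.

Let hm X Y Z : h X Y Z
  = tri (dc (bh_Im B c) (fun y => mxC (lower (bh_g B c y) (bh_Im B c y))) x) X Y Z.
Proof. by apply: eq_tri => i j l; rewrite bh_dcm. Qed.

Let hp X Y Z : h X Y Z
  = - tri (dc (bh_Ip B c) (fun y => mxC (lower (bh_g B c y) (bh_Ip B c y))) x) X Y Z.
Proof.
rewrite -triN1 -[- X]scaleN1r triZ1 /h /tri mulr_sumr; apply: eq_bigr => i _.
rewrite mulr_sumr; apply: eq_bigr => j _; rewrite mulr_sumr; apply: eq_bigr => l _.
by rewrite bh_dcp //; move: (dc _ _ _ _ _ _) => t; rewrite !mulrA mulN1r.
Qed.

Let hK X Y Z : h X Y Z = ins2 (mulmx K) h X Y Z.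
Proof.
by rewrite hm (dc_ins2 (@bh_Im_orth _ _ _ B) ac Ux) /ins2 -!hm.
Qed.

Let hJ X Y Z : h X Y Z = ins2 (mulmx J) h X Y Z.
Proof.
rewrite /ins2 !hp (dc_ins2 (@bh_Ip_orth _ _ _ B) ac Ux) /ins2.
by rewrite !opprD.
Qed.

Let nablaK X Y Z : 2%:R * (k X Y Z + L X (K *m Y) Z + L X Y (K *m Z))
  = h X (K *m Y) Z + h X Y (K *m Z).
Proof. by rewrite !hm -(nabla_dc (@bh_Im_orth _ _ _ B) ac Ux). Qed.

Let nablaJ X Y Z : 2%:R * (L X (J *m Y) Z + L X Y (J *m Z))
  = - (h X (J *m Y) Z + h X Y (J *m Z)).
Proof.
rewrite !hp -opprD opprK -(nabla_dc (@bh_Ip_orth _ _ _ B) ac Ux) /nabla.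
(* In a holomorphic chart [J] is constant, so only the Christoffel terms of [nabla] remain. *)
rewrite [X in _ = _ * (X + _ + _)](_ : _ = 0) ?add0r //.
rewrite /tri big1 // => i _; rewrite big1 // => j _; rewrite big1 // => l _.
rewrite (mder_local (B := fun=> stdJ R m) i oU Ux hc.2) mder_cst.
by rewrite mxCE map_mx0 trmx0 mul0mx mxE !mul0r.
Qed.

Let b j := sharp G (dz R m) j.

Let b_antihol j : antihol iC J (b j).
Proof.
apply: sharp_antihol; first exact: mxC_unit; first exact: (mxC_skewp B ac Ux).
by rewrite JE; exact: dzmx_stdmx (iC2 R).
Qed.

Let dir_der (X : 'cV[C]_n) j l :
  \sum_a X a 0 * (dz R m *m frame_der G K DG DK a *m (dz R m)^T) j l
  = k X (b l) (b j) + g' X (b l) (K *m b j).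
Proof.
apply: frame_der_dir; [exact: mxC_unit | exact: mxC_sym | exact: mxC_skewm | by []].
Qed.

Let zvec s l : 'cV[C]_n := col l (2%:R^-1 *: (dzmx m s)^T).

(** Stated for both kinds of derivative: [s] = i is the direction d/dzbar_l and [s] = -i the
    direction d/dz_l. *)
Let dir_zcomp s l i j :
  2%:R^-1 * (pderC (lshift m l) (fun y => zcomp (sigma_plus B) c y i j) x
    + s * pderC (rshift m l) (fun y => zcomp (sigma_plus B) c y i j) x)
  = - (2%:R * iC) * (k (zvec s l) (b j) (b i) + g' (zvec s l) (b j) (K *m b i)).
Proof.
rewrite -dir_der -(sum_dzmx s l
  (fun a => pderC a (fun y => zcomp (sigma_plus B) c y i j) x)) mulr_sumr; apply: eq_bigr => a _.
by rewrite zcomp_pder [zvec s l a 0]mxE mulrCA.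
Qed.

Let kg_facts : [/\ (forall X Y Y' Z, L X (Y + Y') Z = L X Y Z + L X Y' Z),
  (forall u X Y Z, L X (u *: Y) Z = u * L X Y Z),
  (forall u X Y Z, L X Y (u *: Z) = u * L X Y Z),
  (forall X Y Z, L Y X Z = L X Y Z) &
  (forall X Y Z, L X Y Z + L X Z Y = g' X Y Z)].
Proof.
split=> *; rewrite /L.
- exact: triD2.
- exact: triZ2.
- exact: triZ3.
- exact: chris_sym.
- exact: chris_metric.
Qed.

Let zvec_antihol l : antihol iC J (zvec iC l).
Proof. by rewrite JE; apply: stdmx_zvec; exact: iC2. Qed.

Lemma zcomp_der_zbar l i j : der_zbar l (fun y => zcomp (sigma_plus B) c y i j) x = 0.
Proof.
rewrite /der_zbar dir_zcomp; apply/eqP; rewrite mulf_eq0; apply/orP; right; apply/eqP.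
have [LD LZ2 LZ3 Lsym Lm] := kg_facts.
apply: (dbar_bivector (iC2 R) (mxC_sq ac Ux (bh_Ip B)) LD LZ2 LZ3 Lsym Lm _ _
  hswap hflip hJ nablaJ nablaK (zvec_antihol l) (b_antihol j) (b_antihol i)).
- by move=> *; exact: triD2.
- by move=> *; exact: triZ2.
Qed.

Let zcomp_entry i l : zcomp (sigma_plus B) c x i l
  = 2%:R * iC * (dz R m *m (K *m b i)) l 0.
Proof.
rewrite zcompE //.
have -> : mxC (frame x) = K *m invmx G by rewrite /frame !mxCE map_mxM map_invmx.
rewrite -!scalemxAl mxE (dz_frame_entry _ (mxC_unit B ac Ux)) ?mulrNN //.
- exact: mxC_sym.
- exact: mxC_skewm.
Qed.

Let ee X Y Z := k (holpart iC J (K *m X)) Z Y + g' (holpart iC J (K *m X)) Z (K *m Y).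

(** Contracting the bivector with dz_i gives, up to a factor, the T^{1,0} part of [K *m b i], so the
    sum over [a] is one directional derivative. The constant is the product of 2i from [zcomp_entry]
    and -2i from [dir_zcomp]. *)
Lemma schouten_term i j l :
  \sum_a zcomp (sigma_plus B) c x i a
     * der_z a (fun y => zcomp (sigma_plus B) c y j l) x
  = - (2%:R * iC) ^+ 2 * ee (b i) (b j) (b l).
Proof.
pose v := dz R m *m (K *m b i).
(* The entries of [v] are the values of the dz_a on [K *m b i]; [dzmx_resolution] rebuilds the
   holomorphic part from them. *)
have vE : holpart iC J (K *m b i) = 2%:R^-1 *: (dzmx m (- iC))^T *m v.
  rewrite /v (mulmxA _ (dz R m)) (_ : dz R m = dzmx m iC) // (dzmx_resolution m (iC2 R)) -JE.
  by rewrite /holpart /typeproj -scalemxAl mulmxDl mul1mx -scalemxAl scaleNr.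
rewrite /ee -dir_der vE mulr_sumr.
under eq_bigr => a _.
  rewrite /der_z -mulNr dir_zcomp -dir_der zcomp_entry -/v.
  rewrite mulr_sumr mulr_sumr.
  over.
rewrite exchange_big; apply: eq_bigr => a _ /=.
rewrite [(_ *m v) a 0]mxE mulr_suml mulr_sumr; apply: eq_bigr => d _.
rewrite [zvec _ _ _ _]mxE.
move: (_ a d) (v d 0) ((_ *m _) j l) (2%:R * iC) => p q r s; ring.
Qed.

Lemma schouten_zcomp i j l :
  schouten (zcomp (sigma_plus B) c) (zcomp (sigma_plus B) c) x i j l = 0.
Proof.
have [LD LZ2 LZ3 Lsym Lm] := kg_facts.
have J0 : ee (b i) (b j) (b l) + ee (b j) (b l) (b i) + ee (b l) (b i) (b j) = 0.
  apply: (jacobi_bivector (iC2 R) (mxC_sq ac Ux (bh_Ip B)) LD LZ2 LZ3 Lsym Lm _ _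
    hswap hflip hJ hK nablaJ nablaK (b_antihol i) (b_antihol j) (b_antihol l)).
  - by move=> *; exact: triD2.
  - by move=> *; exact: triZ2.
pose z := zcomp (sigma_plus B) c.
have half : \sum_a (z x i a * der_z a (fun y => z y j l) x
    + z x j a * der_z a (fun y => z y l i) x + z x l a * der_z a (fun y => z y i j) x) = 0.
  rewrite big_split big_split.
  apply: etrans (congr2 +%R (congr2 +%R (schouten_term i j l) (schouten_term j l i))
    (schouten_term l i j)) _.
  exact: scaled_sum_eq0.
by apply: etrans (congr2 +%R half half) _; rewrite addr0.
Qed.

End AtPoint.
End Poisson.

Theorem proposition5 (R : realType) (m : nat) (M : smoothManifold R (m + m))
    (B : bihermitian M) :
  holomorphic_poisson (bh_Ip B) (sigma_plus B).
Proof.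
split; last by move=> c hc x Ux i j k; exact: schouten_zcomp.
split=> [|c hc i j x Ux]; first exact: sigma_plus_section.
have [dRe dIm] := zcomp_diff hc Ux i j.
by split => // l; exact: zcomp_der_zbar.
Qed.
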